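(* Let $I\subsetneq P=\Bbbk[x_1,\dots,x_n]$ be a non-zero proper homogeneous ideal, $H$ a homogeneous Pommaret basis of $I$ of degree $q=\max_{h\in H}\deg h$ for a class respecting term order $\prec$, and $d=\min_{h\in H}\mathrm{cls}\,h$. The algebra $A=P/I$ is Cohen-Macaulay if and only if $\langle H,x_1,\dots,x_{d-1}\rangle_q=P_q$.
   Context: $\Bbbk$ is a field; for a homogeneous ideal $J$, $J_q$ denotes its homogeneous component of degree $q$, and $P_q$ the space of homogeneous polynomials of degree $q$. The class of $\mu\in\mathbb{N}_0^n$ is $\mathrm{cls}\,\mu=\min\{i\mid\mu_i\ne0\}$, with $\mathrm{cls}\,0=n$; for $f\neq0$, $\mathrm{cls}\,f$ is the class of the leading exponent $\mathrm{le}_\prec f$. A term order $\prec$ is class respecting if for multi indices with $|\mu|=|\nu|$ (same total degree) $\mathrm{cls}\,\mu<\mathrm{cls}\,\nu$ implies $\mu\prec\nu$. The Pommaret cone of $\mu$ is $C_P(\mu)=\{\mu+\rho\mid\rho\in\mathbb{N}_0^n,\ \rho_j=0\text{ for all }j>\mathrm{cls}\,\mu\}$. A Pommaret basis of $I$ for $\prec$ is a finite set $H\subset I\setminus\{0\}$ with pairwise distinct leading exponents such that $\mathrm{le}_\prec I=\{\mathrm{le}_\prec f\mid0\ne f\in I\}$ is the disjoint union of the cones $C_P(\mathrm{le}_\prec h)$, $h\in H$; it is homogeneous if all its elements are. The graded algebra $A$ is Cohen-Macaulay if its depth (maximal length of an $A$-regular sequence of homogeneous elements of positive degree) equals its Krull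 dimension. *)

(* Defs.v *)
From HB Require Import structures.
From mathcomp Require Import all_boot all_order all_algebra.
From mathcomp Require Export mpoly.

Set Implicit Arguments.
Unset Strict Implicit.
Unset Printing Implicit Defensive.

Import GRing.Theory.

#[local] Open Scope ring_scope.
#[local] Open Scope quotient_scope.

Section Exponents.

Variable n : nat.
Implicit Types (mu nu rho : 'X_{1..n}) (le : rel 'X_{1..n}).

(* The variable x_k is 'X_i with i = k - 1, whereas classes are 1-based: if
   mu <> 0, then [find] is the least 0-based index i with mu_i <> 0. *)
Definition cls mu : nat :=
  if mu == 0%MM then n else (find (fun i => mu i != 0%N) (enum 'I_n)).+1.

(* A term order is given by its reflexive relation; [strict le] is its strict
   part. *)
Definition term_order le : Prop :=
  [/\ reflexive le, antisymmetric le, transitive le, total le &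
      (forall mu, le 0%MM mu) /\
      (forall mu nu rho, le mu nu -> le (mu + rho)%MM (nu + rho)%MM)].

Definition strict le mu nu : bool := (mu != nu) && le mu nu.

Definition class_respecting le : Prop :=
  forall mu nu, mdeg mu = mdeg nu -> (cls mu < cls nu)%N -> strict le mu nu.

Definition pommaret_cone mu nu : Prop :=
  exists2 rho, nu = (mu + rho)%MM &
    forall j : 'I_n, (cls mu < j.+1)%N -> rho j = 0%N.

(* 0 is the least exponent of a term order, so starting from 0 is harmless
   when f != 0; this is the library's [mlead] for an arbitrary order. *)
Definition lexp (K : fieldType) le (f : {mpoly K[n]}) : 'X_{1..n} :=
  foldr (fun m acc => if le acc m then m else acc) 0%MM (msupp f).

End Exponents.

(* An [idealr] is a boolean predicate that is a proper ideal (it excludes 1);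
   classically every proper ideal is of this form. *)
Definition homogeneous_ideal (K : fieldType) (n : nat)
    (I : idealr {mpoly K[n]}) : Prop :=
  forall (e : nat) (f : {mpoly K[n]}), f \in I -> pihomog mdeg e f \in I.

(* The requirement that leading exponents are pairwise distinct also makes the
   list H duplicate-free, so that it represents a finite set. *)
Definition pommaret_basis (K : fieldType) (n : nat) (le : rel 'X_{1..n})
    (I : idealr {mpoly K[n]}) (H : seq {mpoly K[n]}) : Prop :=
  [/\ (forall h, h \in H -> h \in I /\ h != 0),
      uniq [seq lexp le h | h <- H],
      (forall nu, (exists f, [/\ f \in I, f != 0 & lexp le f = nu]) <->
                  (exists2 h, h \in H & pommaret_cone (lexp le h) nu)) &
      (forall g h nu, g \in H -> h \in H -> g != h ->
         ~ (pommaret_cone (lexp le g) nu /\ pommaret_cone (lexp le h) nu))].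

Definition homogeneous_pommaret_basis (K : fieldType) (n : nat)
    (le : rel 'X_{1..n}) (I : idealr {mpoly K[n]}) (H : seq {mpoly K[n]}) :
    Prop :=
  pommaret_basis le I H /\ (forall h, h \in H -> h \is homog mdeg).

Definition gen_ideal (R : comNzRingType) (s : seq R) (x : R) : Prop :=
  exists c : 'I_(size s) -> R, x = \sum_(i < size s) c i * s`_i.

Definition hcomp (K : fieldType) (n : nat) (J : {mpoly K[n]} -> Prop) (q : nat)
    (f : {mpoly K[n]}) : Prop :=
  J f /\ f \is q.-homog.

Definition regular_seq (R : comNzRingType) (s : seq R) : Prop :=
  (forall i : 'I_(size s), forall b : R,
     gen_ideal (take i s) (s`_i * b) -> gen_ideal (take i s) b) /\
  ~ gen_ideal s 1.

Definition is_max (P : nat -> Prop) (m : nat) : Prop :=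
  P m /\ forall k, P k -> (k <= m)%N.

(* A chain p_0 < ... < p_l of prime ideals has length l. *)
Definition prime_chain (R : comNzRingType) (l : nat) : Prop :=
  exists p : 'I_l.+1 -> prime_idealr R,
    forall i j : 'I_l.+1, (i < j)%N ->
      {subset p i <= p j} /\ exists2 x, x \in p j & x \notin p i.

Definition is_krull_dim (R : comNzRingType) (m : nat) : Prop :=
  is_max (prime_chain R) m.

(* Elements of A = P/I that are homogeneous of positive degree. *)
Definition quot_pos_homog (K : fieldType) (n : nat)
    (I : idealr {mpoly K[n]}) (a : {ideal_quot I}) : Prop :=
  exists e : nat, exists2 f : {mpoly K[n]},
    (0 < e)%N /\ f \is e.-homog & a = \pi_({ideal_quot I}) f.

Definition is_graded_depth (K : fieldType) (n : nat)
    (I : idealr {mpoly K[n]}) (m : nat) : Prop :=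
  is_max (fun r => exists s : seq {ideal_quot I},
    [/\ size s = r, (forall a, a \in s -> quot_pos_homog a) &
        regular_seq s]) m.

Definition cohen_macaulay_quot (K : fieldType) (n : nat)
    (I : idealr {mpoly K[n]}) : Prop :=
  exists m : nat, is_graded_depth I m /\ is_krull_dim {ideal_quot I} m.

(* Main.v *)
(* Put J = I + (x_1, ..., x_{d-1}). As the order is class respecting, a
   homogeneous f in J whose leading exponent has class at least d has the leading
   exponent of an element of I. Since all basis elements have class at least d,
   x_1, ..., x_{d-1} is a regular sequence on A, and P/J has a nonzero socle. By
   Koszul cohomology no homogeneous regular sequence of A is longer than d-1, so
   the depth is d-1.
   The degree q condition holds as soon as a power of x_d lies in J. It makes A
   finite over k[x_1, ..., x_{d-1}], so that dim A <= d-1, by counting dimensions: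
   elements y_i of p_i outside p_{i-1} are algebraically independent for every
   chain of primes p_0 < ... < p_l. If no power of x_d lies in J, a prime over J
   avoiding x_d lies strictly below the irrelevant ideal, and the regular sequence
   provides d-1 further steps below it, so dim A >= d. *)
Require Import Defs.
From HB Require Import structures.
From mathcomp Require Import all_boot all_order all_algebra.
From mathcomp Require boolp classical_sets.

Set Implicit Arguments.
Unset Strict Implicit.
Unset Printing Implicit Defensive.

Import GRing.Theory.

#[local] Open Scope ring_scope.

(** * Regular sequences and Koszul cohomology *)

(** Unlike [idealr], these ideals are arbitrary propositions and may contain 1. *)
Definition is_ideal (R : comNzRingType) (J : R -> Prop) : Prop :=
  J 0 /\ forall a u v, J u -> J v -> J (a * u + v).

Section IdealPredicates.

Variables (R : comNzRingType) (J : R -> Prop).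
Hypothesis idJ : is_ideal J.

Lemma ideal_mul a u : J u -> J (a * u).
Proof. by case: idJ => J0 Jl Ju; have := Jl a u 0 Ju J0; rewrite addr0. Qed.

Lemma ideal_add u v : J u -> J v -> J (u + v).
Proof. by case: idJ => _ Jl Ju Jv; have := Jl 1 u v Ju Jv; rewrite mul1r. Qed.

Lemma ideal_opp u : J u -> J (- u).
Proof. by rewrite -mulN1r; exact: ideal_mul. Qed.

Lemma ideal_sub u v : J u -> J v -> J (u - v).
Proof. by move=> Ju /ideal_opp; exact: ideal_add. Qed.

Lemma ideal_sum (T : Type) (r : seq T) (P : pred T) (F : T -> R) :
  (forall i, P i -> J (F i)) -> J (\sum_(i <- r | P i) F i).
Proof. by move=> JF; apply: big_ind => //; [case: idJ | exact: ideal_add]. Qed.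

End IdealPredicates.

Section GeneratedIdeals.

Variable R : comNzRingType.
Implicit Types (s : seq R) (J : R -> Prop).

Lemma gen_ideal_is_ideal s : is_ideal (gen_ideal s).
Proof.
split=> [|a u v [c ->] [c' ->]].
  by exists (fun=> 0); rewrite big1 // => i _; rewrite mul0r.
exists (fun i => a * c i + c' i); rewrite mulr_sumr -big_split /=.
by apply: eq_bigr => i _; rewrite mulrDl mulrA.
Qed.

Lemma gen_ideal_mem s x : x \in s -> gen_ideal s x.
Proof.
move=> sx; have lt_x : (index x s < size s)%N by rewrite index_mem.
exists (fun i => (i == Ordinal lt_x)%:R).
rewrite (bigD1 (Ordinal lt_x)) //= eqxx mul1r nth_index // big1 ?addr0 //.
by move=> i /negPf->; rewrite mul0r.
Qed.

Lemma gen_ideal_min s J : is_ideal J -> (forall x, x \in s -> J x) ->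
  forall x, gen_ideal s x -> J x.
Proof.
move=> idJ sJ x [c ->]; apply: ideal_sum => // i _.
by apply: ideal_mul => //; apply/sJ/mem_nth.
Qed.

Lemma gen_ideal_sub s1 s2 : {subset s1 <= s2} ->
  forall x, gen_ideal s1 x -> gen_ideal s2 x.
Proof.
move=> s12; apply: gen_ideal_min => [|x /s12]; first exact: gen_ideal_is_ideal.
exact: gen_ideal_mem.
Qed.

Lemma gen_ideal_rcons s a x :
  gen_ideal (rcons s a) x <-> exists b, gen_ideal s (x - a * b).
Proof.
have idr := gen_ideal_is_ideal (rcons s a); have ids := gen_ideal_is_ideal s.
split=> [|[b /(@gen_ideal_sub _ (rcons s a)) sx]]; last first.
  rewrite -(subrK (a * b) x); apply: ideal_add => //.
    by apply: sx => y sy; rewrite mem_rcons inE sy orbT.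
  rewrite mulrC; apply: ideal_mul => //; apply: gen_ideal_mem.
  by rewrite mem_rcons mem_head.
move: x; apply: gen_ideal_min => [|x].
  split=> [|c u v [b ub] [b' vb]].
    by exists 0; rewrite mulr0 subr0; case: ids.
  exists (c * b + b'); rewrite mulrDr opprD addrACA mulrCA -mulrBr.
  by apply: ideal_add => //; apply: ideal_mul.
rewrite mem_rcons inE => /orP[/eqP->|sx].
  by exists 1; rewrite mulr1 subrr; case: ids.
by exists 0; rewrite mulr0 subr0; apply: gen_ideal_mem.
Qed.

Definition weakly_regular s : Prop :=
  forall i : 'I_(size s), forall b : R,
    gen_ideal (take i s) (s`_i * b) -> gen_ideal (take i s) b.

End GeneratedIdeals.

Section KoszulCochains.

Variables (R : comNzRingType) (T : finType) (x : T -> R).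
Implicit Types (c : seq T -> R) (J : R -> Prop).

(* The value of the coboundary of [c] at [i_0, ..., i_p] is the alternating sum
   of the x_{i_k} c(i_0, ..., i_p without i_k). No alternation is required from
   [c], and the recursion makes [c |-> c (i :: -)] a homotopy from x_i to 0. *)
Fixpoint koszul_d c (s : seq T) : R :=
  if s is i :: s' then x i * c s' - koszul_d (fun t => c (i :: t)) s' else 0.

Lemma koszul_dB c c' s :
  koszul_d (fun t => c t - c' t) s = koszul_d c s - koszul_d c' s.
Proof.
elim: s c c' => [|i s IHs] c c' /=; first by rewrite subr0.
by rewrite IHs mulrBr !opprB addrACA [RHS]addrACA [- _ + _]addrC.
Qed.

Lemma koszul_dZ a c s : koszul_d (fun t => a * c t) s = a * koszul_d c s.
Proof.
elim: s c => [|i s IHs] c /=; first by rewrite mulr0.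
by rewrite IHs mulrBr mulrCA.
Qed.

Lemma koszul_d_sum (e : T -> R) (F : T -> seq T -> R) s :
  koszul_d (fun t => \sum_i e i * F i t) s = \sum_i e i * koszul_d (F i) s.
Proof.
elim: s F => [|j s IHs] F /=; first by rewrite big1 // => i _; rewrite mulr0.
rewrite IHs mulr_sumr -sumrB; apply: eq_bigr => i _.
by rewrite mulrBr mulrCA.
Qed.

Lemma koszul_dd c s : koszul_d (koszul_d c) s = 0.
Proof.
elim: s c => //= i s IHs c.
by rewrite koszul_dB koszul_dZ IHs subr0 subrr.
Qed.

Lemma koszul_d_ideal J (idJ : is_ideal J) c p :
  (forall s, size s = p -> J (c s)) ->
  forall s, size s = p.+1 -> J (koszul_d c s).
Proof.
move=> Jc s; elim: s c p Jc => //= i s IHs c p Jc [sz_s].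
apply: ideal_sub => //; first by apply: ideal_mul => //; apply: Jc.
case: p => [|p] in Jc sz_s *; first by move/size0nil: sz_s => -> /=; case: idJ.
by apply: (IHs _ p) => // t sz_t; apply: Jc => /=; rewrite sz_t.
Qed.

(* Vanishing in degree [p] of the cohomology of cochains with values in R/J. *)
Definition koszul_acyclic J (p : nat) : Prop :=
  forall c, (forall s, size s = p.+1 -> J (koszul_d c s)) ->
  exists w, forall s, size s = p -> J (c s - koszul_d w s).

Lemma eq_koszul_acyclic J J' p : (forall b, J b <-> J' b) ->
  koszul_acyclic J p -> koszul_acyclic J' p.
Proof.
move=> eqJ acyc c dc; have [s /dc/eqJ//|w cw] := acyc c.
by exists w => s /cw/eqJ.
Qed.

Definition nonzerodivisor_mod J a : Prop := forall b, J (a * b) -> J b.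

Definition add_ideal J a : R -> Prop := fun b => exists e, J (b - a * e).

(** Being a combination of the x_i, a acts as zero on Koszul cohomology, so the connecting map from
    H^(p-1) of R/(J, a) to H^p of R/J is onto. *)
Lemma koszul_acyclic_of_quotient J (e : T -> R) (m : nat) :
  is_ideal J -> nonzerodivisor_mod J (\sum_i e i * x i) ->
  (forall p, (p < m)%N ->
     koszul_acyclic (add_ideal J (\sum_i e i * x i)) p) ->
  forall p, (p < m.+1)%N -> koszul_acyclic J p.
Proof.
set a := \sum_i _ => idJ nzd_a acyc p lt_p c dc.
pose hc t := \sum_i e i * c (i :: t).
(* Weight the recursion for [koszul_d c (i :: s)] by [e i] and sum over [i]. *)
have homotopy s : size s = p -> J (a * c s - koszul_d hc s).
  move=> sz_s; rewrite koszul_d_sum mulr_suml -sumrB.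
  apply: ideal_sum => // i _; rewrite -mulrA -mulrBr; apply: ideal_mul => //.
  by apply: (dc (i :: s)); rewrite /= sz_s.
case: p => [|p] in lt_p dc homotopy *.
  exists (fun=> 0) => s /size0nil-> /=; rewrite subr0; apply: nzd_a.
  by have := homotopy [::] erefl; rewrite /= subr0.
have [w hcw] : exists w, forall s, size s = p ->
    add_ideal J a (hc s - koszul_d w s).
  apply: acyc => // s sz_s; exists (c s).
  by rewrite -opprB; apply: ideal_opp => //; exact: homotopy.
have [v hcwv] : exists v : seq T -> R, forall s, size s = p ->
    J (hc s - koszul_d w s - a * v s).
  have /boolp.choice[v vP] : forall s, exists b,
      size s = p -> J (hc s - koszul_d w s - a * b).
    move=> s; case: (eqVneq (size s) p) => [/hcw[b Jb]|ne_sz]; first by exists b.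
    by exists 0 => sz_s; rewrite sz_s eqxx in ne_sz.
  by exists v => s /vP.
(* Modulo J, hc = dw + a v; applying d gives a c = a dv, and a cancels. *)
exists v => s sz_s; apply: nzd_a; rewrite mulrBr.
have := koszul_d_ideal idJ hcwv sz_s.
rewrite !koszul_dB koszul_dZ koszul_dd subr0 => Jv.
have := ideal_sub idJ (homotopy s sz_s) (ideal_opp idJ Jv).
by rewrite opprK addrA subrK.
Qed.

(** Exactness of H^p(R/J) -> H^p(R/(J, a)) -> H^(p+1)(R/J): if dc = a v modulo J, then v is a
    cocycle, v = dw, and c - a w is a cocycle modulo J. *)
Lemma koszul_acyclic_quotient J a (m : nat) :
  is_ideal J -> nonzerodivisor_mod J a ->
  (forall p, (p < m.+1)%N -> koszul_acyclic J p) ->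
  forall p, (p < m)%N -> koszul_acyclic (add_ideal J a) p.
Proof.
move=> idJ nzd_a acyc p lt_p c dc.
have [v dcv] : exists v : seq T -> R, forall s, size s = p.+1 ->
    J (koszul_d c s - a * v s).
  have /boolp.choice[v vP] : forall s, exists b,
      size s = p.+1 -> J (koszul_d c s - a * b).
    move=> s; case: (eqVneq (size s) p.+1) => [/dc[b Jb]|ne_sz]; first by exists b.
    by exists 0 => sz_s; rewrite sz_s eqxx in ne_sz.
  by exists v => s /vP.
have /(acyc p.+1 lt_p)[w vw] : forall s, size s = p.+2 -> J (koszul_d v s).
  move=> s sz_s; apply: nzd_a.
  have := koszul_d_ideal idJ dcv sz_s.
  rewrite koszul_dB koszul_dd koszul_dZ sub0r => /(ideal_opp idJ).
  by rewrite opprK.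
have /(acyc p (ltnW lt_p))[z cz] :
    forall s, size s = p.+1 -> J (koszul_d (fun t => c t - a * w t) s).
  move=> s sz_s; rewrite koszul_dB koszul_dZ.
  rewrite -(subrK (a * v s) (koszul_d c s)) -addrA -mulrBr.
  by apply: ideal_add; [|apply: dcv|apply: ideal_mul => //; apply: vw].
exists z => s sz_s; exists (w s).
by have := cz s sz_s; rewrite addrAC.
Qed.

Lemma gen_ideal_take s k : (k < size s)%N ->
  forall b, gen_ideal (take k.+1 s) b <-> add_ideal (gen_ideal (take k s)) s`_k b.
Proof. by move=> lt_k b; rewrite (take_nth 0) //; exact: gen_ideal_rcons. Qed.

Lemma weakly_regular_nth s k : weakly_regular s -> (k < size s)%N ->
  nonzerodivisor_mod (gen_ideal (take k s)) s`_k.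
Proof. by move=> reg_s lt_k b; apply: (reg_s (Ordinal lt_k)). Qed.

(* If [s] is shorter than [a], regularity of [a] makes the Koszul cohomology of
   R vanish below [size a], so the one of R/(s) vanishes in degree 0. *)
Lemma socle_mod_short_regular_seq (s a : seq R) (z : R) :
  weakly_regular s -> weakly_regular a -> (size s < size a)%N ->
  (forall b, b \in a -> exists e : T -> R, b = \sum_i e i * x i) ->
  (forall i, gen_ideal s (x i * z)) -> gen_ideal s z.
Proof.
move=> reg_s reg_a lt_sa a_x socle.
(* Each element dropped from the end of [a] gains one degree of vanishing; the full sequence starts
   with the empty range. *)
have acyc_a k : (k <= size a)%N -> forall p, (p < k)%N ->
    koszul_acyclic (gen_ideal (take (size a - k) a)) p.
  elim: k => // k IHk lt_k; set j := (size a - k.+1)%N.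
  have lt_j : (j < size a)%N by rewrite /j ltn_subrL (leq_ltn_trans _ lt_k).
  have [e def_aj] := a_x _ (mem_nth 0 lt_j).
  apply: (@koszul_acyclic_of_quotient _ e); first exact: gen_ideal_is_ideal.
    by rewrite -def_aj; apply: weakly_regular_nth.
  move=> p lt_pk; rewrite -def_aj.
  apply: eq_koszul_acyclic (IHk (ltnW lt_k) p lt_pk) => b.
  by rewrite -(subnSK lt_k); apply: gen_ideal_take.
(* Each element of [s] divided out costs one degree. *)
have acyc_s k : (k <= size s)%N -> forall p, (p < size a - k)%N ->
    koszul_acyclic (gen_ideal (take k s)) p.
  elim: k => [|k IHk] lt_k p; rewrite ?subn0 => lt_p.
    by have := acyc_a _ (leqnn _) p lt_p; rewrite subnn !take0.
  have lt_ka : (k < size a)%N by apply: leq_trans lt_k (ltnW lt_sa).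
  apply: (@eq_koszul_acyclic (add_ideal (gen_ideal (take k s)) s`_k)).
    by move=> b; split=> /(gen_ideal_take lt_k).
  apply: (@koszul_acyclic_quotient _ _ (size a - k.+1)) => //.
  - exact: gen_ideal_is_ideal.
  - exact: weakly_regular_nth.
  - by rewrite subnSK //; apply: IHk (ltnW lt_k).
have lt0 : (0 < size a - size s)%N by rewrite subn_gt0.
(* By the socle hypothesis [z] is a 0-cocycle modulo (s), and 0-coboundaries are zero. *)
have [|w /(_ [::] erefl)] := acyc_s _ (leqnn _) 0%N lt0 (fun=> z).
  by case=> [|i []] //= _; rewrite take_size subr0.
by rewrite take_size /= subr0.
Qed.

End KoszulCochains.

(** * Chains of primes *)

Section PrimeIdeals.

Variable R : comNzRingType.
Implicit Types (J Q S : R -> Prop).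

Lemma prime_idealr_of_predicate Q : is_ideal Q -> ~ Q 1 ->
  (forall u v, Q (u * v) -> Q u \/ Q v) ->
  exists p : prime_idealr R, forall u, u \in p <-> Q u.
Proof.
move=> idQ Q1 Qprime; pose P : R -> bool := fun u => boolp.asbool (Q u).
have PE u : reflect (Q u) (u \in P) by exact: boolp.asboolP.
have closedP : idealr_closed P.
  case: (idQ) => Q0 Ql; split; [exact/PE | by apply/PE |].
  by move=> a u v /PE Qu /PE Qv; apply/PE/Ql.
have primeP : prime_idealr_closed P.
  by move=> u v /PE/Qprime[] /PE->; rewrite ?orbT.
pose pI := isIdealr.Build R P closedP.
pose pP := isPrimeIdealrClosed.Build R P primeP.
pose p : prime_idealr R := HB.pack P pI pP.
by exists p => u; split=> /PE.
Qed.

Lemma maximal_ideal_avoiding J S : is_ideal J -> (forall u, S u -> ~ J u) ->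
  exists M, [/\ is_ideal M, (forall u, J u -> M u), (forall u, S u -> ~ M u) &
    forall v, ~ M v -> exists b, exists2 m, M m & S (m + b * v)].
Proof.
(* The sets in Zorn's lemma need not contain [J]: the empty chain has an empty union, on which [U]
   gives [J]. *)
move=> idJ JS; pose U (A : classical_sets.set R) u := A u \/ J u.
pose P (A : classical_sets.set R) :=
  is_ideal (U A) /\ forall u, S u -> ~ A u.
have [A [[idA AS] maxA]] : exists A, P A /\
    forall B, classical_sets.proper A B -> ~ P B.
  apply: classical_sets.Zorn_bigcup => F FP totF; split; last first.
    by move=> u Su [X FX]; case: (FP X FX) => _; apply.
  split=> [|a u v uF vF]; first by right; case: idJ.
  have union_in X : F X -> U X (a * u + v) ->
      U (classical_sets.bigcup F id) (a * u + v).
    by move=> FX [Xuv|]; [left; exists X | right].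
  have le_in X Y w : classical_sets.subset X Y -> U X w -> U Y w.
    by move=> XY [/XY|]; [left | right].
  have lin X : F X -> U X u -> U X v -> U X (a * u + v).
    by move=> /FP[[_ lX] _]; apply: lX.
  case: uF vF => [[X FX Xu]|Ju] [[Y FY Yv]|Jv].
  - have [XY|YX] := totF _ _ FX FY.
      apply: (union_in Y) => //; apply: lin => //; last by left.
      by apply: le_in XY _; left.
    apply: (union_in X) => //; apply: lin => //; first by left.
    by apply: le_in YX _; left.
  - by apply: (union_in X) => //; apply: lin => //; [left | right].
  - by apply: (union_in Y) => //; apply: lin => //; [right | left].
  - by right; case: idJ => _; apply.
exists (U A); split=> // [u Ju|u Su [Au|Ju]|v nUv]; first by right.
- exact: AS Su Au.
- exact: JS Su Ju.
apply: boolp.contrapT => no_b.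
pose B u := exists b, U A (u - b * v).
have AB u : U A u -> B u by exists 0; rewrite mul0r subr0.
apply: (maxA B).
  split=> [u Au|BA]; first by apply: AB; left.
  apply: nUv; left; apply: BA; exists 1; rewrite mul1r subrr.
  by case: idA.
have idB : is_ideal B.
  split; first by apply: AB; case: idA.
  move=> c u w [b ub] [b' wb]; exists (c * b + b').
  by rewrite mulrDl opprD addrACA -mulrA -mulrBr; case: idA => _; apply.
have JB u : J u -> B u by move=> Ju; apply: AB; right.
split=> [|u Su [b uvA]]; last first.
  by apply: no_b; exists b; exists (u - b * v); rewrite ?subrK.
case: idB => B0 Bl; split=> [|c u w]; first by left.
by move=> [Bu|/JB Bu] [Bw|/JB Bw]; left; apply: Bl.
Qed.

(** An ideal M maximal among those missing S is prime: if u and v lie outside M and u v inside, some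
    elements m + b u and m' + b' v lie in S, and their product lies in both S and M. *)
Lemma prime_ideal_avoiding J S : is_ideal J ->
  S 1 -> (forall u v, S u -> S v -> S (u * v)) -> (forall u, S u -> ~ J u) ->
  exists p : prime_idealr R,
    (forall u, J u -> u \in p) /\ (forall u, S u -> u \notin p).
Proof.
move=> idJ S1 SM JS.
have [M [idM JM MS maxM]] := maximal_ideal_avoiding idJ JS.
have [||p pE] := prime_idealr_of_predicate idM; first exact: (MS 1).
- move=> u v Muv; apply: boolp.contrapT => /boolp.not_orP[Mu Mv].
  have [b [m Mm Smu]] := maxM u Mu; have [b' [m' Mm' Smv]] := maxM v Mv.
  apply: MS (SM _ _ Smu Smv) _.
  rewrite mulrDr; apply: ideal_add => //; first exact: ideal_mul.
  rewrite mulrDl; apply: ideal_add => //; last by rewrite mulrACA; apply: ideal_mul.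
  by rewrite mulrC; apply: ideal_mul.
exists p; split=> [u /JM Mu|u /MS nMu]; first exact/pE.
by apply/negP=> /pE.
Qed.

(* The last hypothesis holds for every nonzerodivisor [a] mod [J]; a regular
   sequence thus yields one strictly smaller prime per element. *)
Lemma smaller_prime J (Q : prime_idealr R) a : is_ideal J ->
  (forall u, J u -> u \in Q) -> (forall k u, J (a ^+ k * u) -> u \in Q) ->
  exists p : prime_idealr R,
    [/\ forall u, J u -> u \in p, {subset p <= Q} & a \notin p].
Proof.
(* A prime missing all products of a power of a with an element outside Q lies in Q and omits a. *)
move=> idJ JQ a_reg; pose S b := exists k, exists2 u, u \notin Q & b = a ^+ k * u.
have [| | |p [Jp pS]] := @prime_ideal_avoiding J S idJ.
- by exists 0%N, 1; rewrite ?idealr1 ?mulr1.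
- move=> _ _ [k [u Qu ->]] [l [v Qv ->]]; exists (k + l)%N, (u * v).
    by rewrite prime_idealrM negb_or Qu.
  by rewrite exprD mulrACA.
- by move=> _ [k [u Qu ->]] /a_reg; apply/negP.
exists p; split=> // [u|]; last by apply: pS; exists 1%N, 1; rewrite ?idealr1 ?mulr1.
by apply: contraLR => Qu; apply: pS; exists 0%N, u; rewrite ?mul1r.
Qed.

(** Indexing by [nat] and comparing neighbours only makes it easy to put a further prime on top. *)
Definition chain_below (l : nat) (Q : prime_idealr R) : Prop :=
  exists p : nat -> prime_idealr R, p l = Q /\
    forall i, (i < l)%N ->
      {subset p i <= p i.+1} /\ exists2 u, u \in p i.+1 & u \notin p i.

Lemma chain_belowS l (p Q : prime_idealr R) u : chain_below l p ->
  {subset p <= Q} -> u \in Q -> u \notin p -> chain_below l.+1 Q.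
Proof.
move=> [c [<- c_lt]] pQ Qu pu; exists (fun i => if (i <= l)%N then c i else Q).
rewrite ltnn; split=> // i; rewrite ltnS => le_il; rewrite le_il.
case: ltnP => [/c_lt//|le_li]; have <- : l = i by apply/eqP; rewrite eqn_leq le_li.
by split=> //; exists u.
Qed.

Lemma prime_chain_of_chain_below l (Q : prime_idealr R) :
  chain_below l Q -> prime_chain R l.
Proof.
move=> [c [_ c_lt]]; exists (fun i : 'I_l.+1 => c i) => i j.
have sub_c k : (i + k <= l)%N -> {subset c i <= c (i + k)%N}.
  elim: k => [|k IHk]; first by rewrite addn0 => _ u.
  rewrite addnS => lt_k u /(IHk (ltnW lt_k)).
  by case: (c_lt _ lt_k) => sub_k _; apply: sub_k.
move=> lt_ij; have le_jl : (j <= l)%N by rewrite -ltnS.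
have {lt_ij} : exists k, (i + k).+1 = j :> nat.
  by exists (j - i.+1)%N; rewrite -addSn subnKC.
move=> [k def_j]; have lt_k : (i + k < l)%N by rewrite def_j.
have sub_k := sub_c k (ltnW lt_k); rewrite -def_j.
have [sub_k1 [u cu c'u]] := c_lt _ lt_k.
split=> [v /sub_k/sub_k1//|]; exists u => //.
by apply: contra c'u; apply: sub_k.
Qed.

(** Descent along the prefixes of [s]: a prime over the first k+1 elements contains, by
    [smaller_prime], a prime over the first k that omits the last one. *)
Lemma regular_seq_chain_below (s : seq R) (Q : prime_idealr R) :
  weakly_regular s -> (forall u, gen_ideal s u -> u \in Q) ->
  chain_below (size s) Q.
Proof.
move=> reg_s; have : (size s <= size s)%N by [].
rewrite -{3}(take_size s); move: {1 3 4}(size s) Q.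
elim=> [|k IHk] Q lt_k sQ; first by exists (fun=> Q).
have idk := gen_ideal_is_ideal (take k s).
have nzd_k := weakly_regular_nth reg_s lt_k.
have Qk u : gen_ideal (take k s) u -> u \in Q.
  move=> su; apply: sQ; rewrite (take_nth 0) //; apply/gen_ideal_rcons.
  by exists 0; rewrite mulr0 subr0.
have [//|j u|p [sp pQ sk_p]] := @smaller_prime _ Q s`_k idk.
  elim: j => [|j IHj]; first by rewrite mul1r; apply: Qk.
  by rewrite exprS -mulrA => /nzd_k.
apply: chain_belowS (IHk p (ltnW lt_k) sp) pQ _ sk_p.
apply: sQ; rewrite (take_nth 0) //; apply: gen_ideal_mem.
by rewrite mem_rcons mem_head.
Qed.

(** This bounds depth by dimension. A prime over (s) exists because (s) misses the multiplicative
    set {1}. *)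
Lemma regular_seq_prime_chain (s : seq R) :
  regular_seq s -> prime_chain R (size s).
Proof.
move=> [reg_s s1]; have ids := gen_ideal_is_ideal s.
have [//|u v <- <-|u <- //|Q [sQ _]] := @prime_ideal_avoiding _ (eq 1) ids.
  by rewrite mulr1.
exact: prime_chain_of_chain_below (regular_seq_chain_below reg_s sQ).
Qed.

End PrimeIdeals.

Lemma left_dependence (K : fieldType) (T1 T2 : finType) (C : T1 -> T2 -> K) :
  (#|T2| < #|T1|)%N ->
  exists2 u : T1 -> K, exists i, u i != 0 &
    forall j, \sum_i u i * C i j = 0.
Proof.
move=> lt_card; pose A := \matrix_(i < #|T1|, j < #|T2|)
  C (enum_val i) (enum_val j).
have : kermx A != 0.
  rewrite -mxrank_eq0 mxrank_ker subn_eq0 -ltnNge.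
  exact: leq_ltn_trans (rank_leq_col A) lt_card.
case/rowV0Pn => v /sub_kermxP vA /rV0Pn[i vi].
exists (fun i => v 0 (enum_rank i)).
  by exists (enum_val i); rewrite enum_valK.
move=> j; transitivity ((v *m A) 0 (enum_rank j)); last by rewrite vA mxE.
rewrite mxE (reindex_onto enum_val enum_rank) => [|k _]; last exact: enum_rankK.
by apply: eq_big => [k|k _]; rewrite ?mxE ?enum_valK ?eqxx ?enum_rankK.
Qed.

(** * Chain lengths by counting dimensions *)

Section ChainBound.

Variables (K : fieldType) (n : nat) (R : comNzRingType).
Variable phi : {rmorphism {mpoly K[n]} -> R}.
Hypothesis phi_surj : forall a, exists f, phi f = a.
Implicit Types (f g : {mpoly K[n]}) (p : nat -> prime_idealr R).

Definition deg_le (e : nat) f : Prop := forall m, m \in msupp f -> (mdeg m <= e)%N.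

Lemma deg_le_weaken e1 e2 f : (e1 <= e2)%N -> deg_le e1 f -> deg_le e2 f.
Proof. by move=> le12 fe m /fe le1; apply: leq_trans le1 le12. Qed.

Lemma deg_le1 : deg_le 0 (1 : {mpoly K[n]}).
Proof. by move=> m; rewrite msupp1 inE => /eqP->; rewrite mdeg0. Qed.

Lemma deg_leM e1 e2 f g : deg_le e1 f -> deg_le e2 g -> deg_le (e1 + e2) (f * g).
Proof.
move=> fe ge m /msuppM_le/allpairsP[[m1 m2] /= [/fe le1 /ge le2 ->]].
by rewrite mdegD leq_add.
Qed.

Lemma deg_leX e f k : deg_le e f -> deg_le (k * e) (f ^+ k).
Proof.
move=> fe; elim: k => [|k IHk]; first exact: deg_le1.
by rewrite exprS mulSn; apply: deg_leM.
Qed.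

Lemma deg_le_exists f : deg_le (msize f) f.
Proof. by move=> m /msize_mdeg_lt/ltnW. Qed.

(** Linear independence over K of the images in R/Q. *)
Definition independent_mod (Q : prime_idealr R) (T : finType)
    (w : T -> {mpoly K[n]}) : Prop :=
  forall c : T -> K, phi (\sum_i c i *: w i) \in Q -> forall i, c i = 0.

Lemma prime_ideal_expM (Q : prime_idealr R) y k u :
  y \notin Q -> y ^+ k * u \in Q -> u \in Q.
Proof.
move=> Qy; elim: k => [|k IHk]; first by rewrite mul1r.
by rewrite exprS -mulrA prime_idealrM (negPf Qy).
Qed.

(* Cancel the lowest power of [y] in a relation modulo [P], then reduce what is
   left modulo [Q], which contains [y]. *)
Lemma independent_mod_powers (P Q : prime_idealr R) (T : finType)
    (w : T -> {mpoly K[n]}) (y : {mpoly K[n]}) (t : nat) :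
  {subset P <= Q} -> phi y \in Q -> phi y \notin P -> independent_mod Q w ->
  independent_mod P (fun ki : 'I_t * T => y ^+ ki.1 * w ki.2).
Proof.
move=> PQ Qy Py ind_w c Pc.
pose W (k : 'I_t) := \sum_i c (k, i) *: w i.
have {Pc} Psum : phi (\sum_k y ^+ (k : 'I_t) * W k) \in P.
  move: Pc; congr (phi _ \in P).
  rewrite [RHS](eq_bigr (fun k : 'I_t =>
    \sum_i c (k, i) *: (y ^+ k * w i))) => [|k _]; last first.
    by rewrite mulr_sumr; apply: eq_bigr => i _; rewrite scalerAr.
  by rewrite pair_bigA; apply: eq_bigr => -[].
have c0 j : forall k : 'I_t, (k < j)%N -> forall i, c (k, i) = 0.
  elim: j => // j IHj k; rewrite ltnS leq_eqVlt.
  move=> /orP[/eqP def_j|]; last exact: IHj.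
  (* For k' < k the truncated exponent is harmless, since [W k'] vanishes by induction. *)
  pose G := \sum_(k' | k' != k) y ^+ (k' - k.+1) * W k'.
  have sumE : \sum_k y ^+ (k : 'I_t) * W k = y ^+ k * (W k + y * G).
    rewrite mulrDr (bigD1 k) //=; congr (_ + _).
    rewrite !mulr_sumr; apply: eq_bigr => k' ne_k.
    have [lt_k|] := ltnP k' k.
      have -> : W k' = 0; last by rewrite !mulr0.
      by rewrite /W big1 // => i _; rewrite IHj ?scale0r // -def_j.
    rewrite leq_eqVlt eq_sym (inj_eq val_inj) (negPf ne_k) /= => lt_k.
    by rewrite !mulrA -exprSr -exprD subnKC.
  move: Psum; rewrite sumE rmorphM rmorphXn => /(prime_ideal_expM Py)/PQ.
  rewrite rmorphD rmorphM => QWG; apply: ind_w.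
  by rewrite -(rpredDr _ (x := phi y * phi G)) // mulrC idealMr.
by case=> k i; apply: (c0 k.+1).
Qed.

(** The family consists of the monomials with exponents below [t] in y_1, ..., y_l, where y_i is in
    p_i but not in p_(i-1). The constant [e], a sum of sizes of the y_i, does not depend on [t]. *)
Lemma independent_mod_chain l p :
  (forall i, (i < l)%N ->
     {subset p i <= p i.+1} /\ exists2 u, u \in p i.+1 & u \notin p i) ->
  exists e, forall t, exists (T : finType) (w : T -> {mpoly K[n]}),
    [/\ #|T| = (t ^ l)%N, forall i, deg_le (e * t) (w i) &
        independent_mod (p 0%N) w].
Proof.
elim: l p => [|l IHl] p p_lt.
  exists 0%N => t; exists unit, (fun=> 1); split=> [|_|c].
  - by rewrite card_unit.
  - by rewrite mul0n; apply: deg_le1.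
  rewrite (bigD1 tt) //= big1 ?addr0 => [p_c []|[]] //.
  apply/eqP; apply: contraT => c_neq0; have := idealr1 (p 0%N).
  rewrite -(rmorph1 phi) -[X in phi X](scalerK c_neq0) -mul_mpolyC rmorphM.
  by rewrite idealMr.
have [|e IHe] := IHl (fun i => p i.+1); first by move=> i; apply: (p_lt i.+1).
have [p01 [b p1y p0y]] := p_lt 0%N isT.
have [y def_b] := phi_surj b; rewrite -{b}def_b in p1y p0y.
exists (e + msize y)%N => t.
have [T [w [cardT deg_w ind_w]]] := IHe t.
exists ('I_t * T)%type, (fun ki : 'I_t * T => y ^+ ki.1 * w ki.2).
split=> [|[k i] /=|].
- by rewrite card_prod card_ord cardT expnS.
- rewrite mulnDl addnC; apply: deg_leM => //.
  apply: deg_le_weaken (deg_leX (@deg_le_exists y)).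
  by rewrite mulnC leq_mul2l ltnW ?orbT.
- exact: independent_mod_powers ind_w.
Qed.

(* Hilbert function estimate: t^l independent elements of degree O(t) cannot
   live in a space of dimension O(t^m) if l > m. *)
Lemma chain_length_le (N m l : nat) :
  (forall e, exists (T : finType) (g : T -> {mpoly K[n]}),
     (#|T| <= N * e.+1 ^ m)%N /\
     forall f, deg_le e f -> exists c : T -> K, phi f = phi (\sum_i c i *: g i)) ->
  prime_chain R l -> (l <= m)%N.
Proof.
move=> span [p' p'_lt]; pose p i := p' (inord i).
have [|e ind] := @independent_mod_chain l p.
  by move=> i lt_i; apply: p'_lt; rewrite !inordK ?ltnS // ltnW.
rewrite leqNgt; apply/negP => lt_ml.
(* With this t, N (e t + 1)^m <= N (e + 1)^m t^m < t^(m+1) <= t^l. *)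
pose t := (N * e.+1 ^ m).+1.
have [T [w [cardT deg_w ind_w]]] := ind t.
have [T2 [g [cardT2 span_g]]] := span (e * t)%N.
have /boolp.choice[C CE] : forall i, exists c : T2 -> K,
  phi (w i) = phi (\sum_j c j *: g j) by move=> i; apply: span_g.
have lt_card : (#|T2| < #|T|)%N.
  apply: leq_ltn_trans cardT2 _; rewrite cardT.
  apply: leq_trans (leq_pexp2l _ lt_ml) => //.
  have le_et : ((e * t).+1 <= e.+1 * t)%N by rewrite mulSn -add1n leq_add2r.
  have le_exp : ((e * t).+1 ^ m <= (e.+1 * t) ^ m)%N.
    by case: (m) => // m'; rewrite leq_exp2r.
  apply: leq_ltn_trans (leq_mul (leqnn N) le_exp) _.
  by rewrite expnMn mulnA expnS ltn_pmul2r ?expn_gt0.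
have [u [i u_i] uC] := left_dependence C lt_card.
case/eqP: u_i; apply: ind_w.
have -> : phi (\sum_i u i *: w i) = 0; last exact: idealr0.
transitivity (phi (\sum_i u i *: \sum_j C i j *: g j)).
  rewrite !rmorph_sum; apply: eq_bigr => k _.
  by rewrite -!mul_mpolyC !rmorphM CE.
under eq_bigr do rewrite scaler_sumr; rewrite exchange_big /= big1 ?rmorph0 //.
move=> j _; under eq_bigr do rewrite scalerA.
by rewrite -scaler_suml uC scale0r.
Qed.

End ChainBound.

(** * Leading exponents and Pommaret bases *)

Section Classes.

Variable n : nat.
Implicit Types m : 'X_{1..n}.

Lemma cls_leq_n m : (cls m <= n)%N.
Proof.
rewrite /cls; case: (eqVneq m 0%MM) => // m_neq0.
have := has_find (fun i => m i != 0%N) (enum 'I_n).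
rewrite size_enum_ord => <-; apply: contraR m_neq0 => /hasPn m0.
by apply/eqP/mnmP => i; rewrite mnm0E; apply/eqP/negPn/m0; rewrite mem_enum.
Qed.

Lemma cls_leq m (i : 'I_n) : m i != 0%N -> (cls m <= i.+1)%N.
Proof.
move=> mi; rewrite /cls; case: (eqVneq m 0%MM) => [m0|_].
  by rewrite m0 mnm0E in mi.
rewrite ltnS -(index_enum_ord i) leqNgt; apply/negP=> /(before_find i).
by rewrite nth_index ?mem_enum // mi.
Qed.

Lemma cls_witness m : m != 0%MM -> exists2 i : 'I_n, cls m = i.+1 & m i != 0%N.
Proof.
move=> m_neq0; have has_m : has (fun i => m i != 0%N) (enum 'I_n).
  apply: contraR m_neq0 => /hasPn m0.
  by apply/eqP/mnmP => i; rewrite mnm0E; apply/eqP/negPn/m0; rewrite mem_enum.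
have [i0 _ _] := hasP has_m.
exists (nth i0 (enum 'I_n) (find (fun i => m i != 0%N) (enum 'I_n))).
  rewrite /cls (negPf m_neq0) nth_enum_ord //.
  by have := has_m; rewrite has_find size_enum_ord.
exact: (nth_find i0 has_m).
Qed.

Lemma lt_cls_eq0 m (i : 'I_n) : (i.+1 < cls m)%N -> m i = 0%N.
Proof.
by move=> lt_i; apply/eqP; apply: contraTT lt_i => /cls_leq; rewrite -leqNgt.
Qed.

(** The bound [k < n] excludes the exponent 0, whose class is n by convention. *)
Lemma cls_leqP m k : (k < n)%N ->
  (cls m <= k)%N <-> exists2 i : 'I_n, (i < k)%N & m i != 0%N.
Proof.
move=> lt_kn; split=> [le_k|[i lt_i /cls_leq le_i]]; last exact: leq_trans lt_i.
have [m0|/cls_witness[i def_i mi]] := eqVneq m 0%MM.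
  by move: le_k; rewrite m0 /cls eqxx leqNgt lt_kn.
by exists i => //; rewrite -def_i.
Qed.

Lemma cls_addl m1 m2 k : (k < n)%N -> (cls m1 <= k)%N -> (cls (m1 + m2)%MM <= k)%N.
Proof.
move=> lt_k /(cls_leqP _ lt_k)[i lt_i m1i]; apply/(cls_leqP _ lt_k).
by exists i; rewrite // mnmDE addn_eq0 negb_and m1i.
Qed.

Lemma ltn_cls_sub m1 m2 k : (k < n)%N -> (m1 <= m2)%MM -> (k < cls m2)%N ->
  (k < cls m1)%N.
Proof.
move=> lt_k le12; rewrite !ltnNge; apply: contra => cls1.
by rewrite -(submK le12) addmC cls_addl.
Qed.

End Classes.

Section LeadingExponents.

Variables (n : nat) (le : rel 'X_{1..n}).
Hypothesis le_term : term_order le.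
Variable K : fieldType.
Implicit Types (f g : {mpoly K[n]}) (m : 'X_{1..n}).

Lemma term_order_refl : reflexive le. Proof. by case: le_term. Qed.
Lemma term_order_anti : antisymmetric le. Proof. by case: le_term. Qed.
Lemma term_order_trans : transitive le. Proof. by case: le_term. Qed.
Lemma term_order_total : total le. Proof. by case: le_term. Qed.
Lemma term_order_ge0 m : le 0%MM m. Proof. by case: le_term => _ _ _ _ []. Qed.

Lemma term_order_add2r r m1 m2 : le (m1 + r)%MM (m2 + r)%MM = le m1 m2.
Proof.
case: le_term => le_refl le_anti _ le_tot [_ le_add].
apply/idP/idP => [le12|]; last exact: le_add.
case/orP: (le_tot m1 m2) => // le21.
suff /addIm-> : (m1 + r)%MM = (m2 + r)%MM by exact: le_refl.
by apply: le_anti; rewrite le12 le_add.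
Qed.

Lemma strict_trans m1 m2 m3 : strict le m1 m2 -> le m2 m3 -> strict le m1 m3.
Proof.
move=> /andP[ne12 le12] le23; rewrite /strict (term_order_trans le12 le23) andbT.
apply: contra ne12 => /eqP def_m3; rewrite def_m3 in le12 *.
by apply/eqP/term_order_anti; rewrite le12.
Qed.

(** Relational form of [lexp]; it forces [f != 0], as [m] lies in the support. *)
Definition is_lead f m : Prop :=
  m \in msupp f /\ forall m', m' \in msupp f -> le m' m.

Lemma lexp_is_lead f : f != 0 -> is_lead f (lexp le f).
Proof.
rewrite -msupp_eq0 /is_lead /lexp; elim: (msupp f) => //= m s IHs _.
have [->|s_neq0] := eqVneq s [::].
  rewrite /= term_order_ge0 mem_head; split=> // m'; rewrite inE => /eqP->.
  exact: term_order_refl.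
have [lead_s max_s] := IHs s_neq0; move: (foldr _ _ s) lead_s max_s => l sl max_s.
have := term_order_total l m; case: ifP => [le_lm _|_ /= le_ml].
  split=> [|m']; rewrite inE ?eqxx // => /orP[/eqP->|/max_s le_m'l].
    exact: term_order_refl.
  exact: term_order_trans le_lm.
by split=> [|m']; rewrite inE ?sl ?orbT // => /orP[/eqP->|/max_s].
Qed.

Lemma is_lead_uniq f m1 m2 : is_lead f m1 -> is_lead f m2 -> m1 = m2.
Proof.
by move=> [f1 max1] [f2 max2]; apply: term_order_anti; rewrite max1 ?max2.
Qed.

Lemma is_lead_neq0 f m : is_lead f m -> f != 0.
Proof. by case=> fm _; apply: contraTneq fm => ->; rewrite msupp0. Qed.

Lemma is_lead_lexp f m : is_lead f m -> lexp le f = m.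
Proof.
move=> lead_m.
exact: is_lead_uniq (lexp_is_lead (is_lead_neq0 lead_m)) lead_m.
Qed.

Lemma is_lead_mulX f m r :
  is_lead (f * 'X_[r]) (m + r)%MM <-> is_lead f m.
Proof.
have suppE m' : (m' + r \in msupp (f * 'X_[r]))%MM = (m' \in msupp f).
  by rewrite !mcoeff_msupp [(m' + r)%MM]addmC mcoeffMX.
split=> -[fm max_m]; split; rewrite ?suppE // in fm *.
  by move=> m'; rewrite -suppE => /max_m; rewrite term_order_add2r.
move=> m'; rewrite (perm_mem (msuppMX _ _)) => /mapP[m'' /max_m le'' ->].
by rewrite [(r + m'')%MM]addmC term_order_add2r.
Qed.

Lemma lead_cancel e f g m : f \is e.-homog -> g \is e.-homog ->
  is_lead f m -> is_lead g m ->
  exists2 c, f - c *: g \is e.-homog &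
    forall m', m' \in msupp (f - c *: g) -> strict le m' m.
Proof.
move=> hf hg [fm maxf] [gm maxg]; exists (f@_m / g@_m).
  by rewrite rpredB ?rpredZ.
move=> m' supp_m'; have /orP le_m' : (m' \in msupp f) || (m' \in msupp g).
  move: supp_m' => /msuppB_le; rewrite mem_cat => /orP[->//|/msuppZ_le->].
  by rewrite orbT.
apply/andP; split; last by case: le_m' => [/maxf|/maxg].
apply: contraTneq supp_m' => ->; rewrite mcoeff_msupp negbK mcoeffB mcoeffZ.
by rewrite divfK ?subrr // -mcoeff_msupp.
Qed.

(** Well-founded induction on the leading exponent: only finitely many exponents have degree at most
    [e], so the sets [below m] shrink strictly. *)
Lemma homog_lead_ind e (Q : {mpoly K[n]} -> Prop) :
  Q 0 ->
  (forall f m, f \is e.-homog -> is_lead f m ->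
     (forall g, g \is e.-homog ->
        (forall m', m' \in msupp g -> strict le m' m) -> Q g) -> Q f) ->
  forall f, f \is e.-homog -> Q f.
Proof.
move=> Q0 Qind.
pose below m : {set 'X_{1..n < e.+1}} := [set b | strict le (bmnm b) m].
suff IH N f : f \is e.-homog ->
    (forall m, m \in msupp f -> (#|below m| < N)%N) -> Q f.
  move=> f hf; apply: (IH #|{: 'X_{1..n < e.+1}}|.+1 f hf) => m _.
  by rewrite ltnS max_card.
elim: N f => [|N IHN] f hf lt_N.
  rewrite [f]msuppnil0 //; case: (msupp f) lt_N => // m s /(_ m).
  by rewrite mem_head => /(_ isT).
have [->//|f_neq0] := eqVneq f 0.
have lead_f := lexp_is_lead f_neq0; set m := lexp le f in lead_f.
apply: (Qind f m) => // g hg lt_g; apply: IHN => // m' gm'.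
apply: leq_trans (_ : #|below m| <= N)%N; last by have [/lt_N] := lead_f.
have lt_m' : (mdeg m' < e.+1)%N by rewrite ltnS (dhomog_mf hg).
apply/proper_card/properP; split.
  apply/subsetP => b; rewrite !inE => /strict_trans; apply.
  by have /andP[] := lt_g m' gm'.
by exists (BMultinom lt_m'); rewrite !inE /= ?lt_g // /strict eqxx.
Qed.

End LeadingExponents.

(** * Supports and homogeneous components *)

Section MonomialSupport.

Variables (K : fieldType) (n : nat).
Implicit Types (f g : {mpoly K[n]}) (m : 'X_{1..n}).

Lemma mcoeff_filter (P : pred 'X_{1..n}) f m :
  (\sum_(m' <- msupp f | P m') f@_m' *: 'X_[m'])@_m = if P m then f@_m else 0.
Proof.
transitivity (\sum_(m' <- msupp f) (P m)%:R * (f@_m' * ('X_[m'])@_m)).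
  rewrite raddf_sum /= big_mkcond; apply: eq_bigr => m' _.
  rewrite mcoeffZ mcoeffX; have [->|ne_m] := eqVneq m' m; case: ifP => _;
    by rewrite ?mulr0 ?mul0r ?mul1r.
rewrite -mulr_sumr; have -> : \sum_(m' <- msupp f) f@_m' * ('X_[m'])@_m = f@_m.
  have /(congr1 (mcoeff m)) -> := mpolyE f; rewrite raddf_sum /=.
  by apply: eq_bigr => m' _; rewrite mcoeffZ.
by case: ifP; rewrite ?mul1r ?mul0r.
Qed.

Lemma mcoeff_pihomog e f m :
  (pihomog mdeg e f)@_m = if mdeg m == e then f@_m else 0.
Proof. by rewrite pihomogE mcoeff_filter. Qed.

Lemma pihomog0E f : pihomog mdeg 0 f = (f@_0%MM)%:MP.
Proof.
apply/mpolyP => m; rewrite mcoeff_pihomog mcoeffC mdeg_eq0.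
by case: eqP => [->|_]; rewrite ?mulr1 ?mulr0.
Qed.

Lemma msupp_pihomog e f m : m \in msupp (pihomog mdeg e f) -> m \in msupp f.
Proof.
by rewrite !mcoeff_msupp mcoeff_pihomog; case: ifP => //; rewrite eqxx.
Qed.

Lemma pihomog_mulX e f m :
  pihomog mdeg (e + mdeg m) (f * 'X_[m]) = pihomog mdeg e f * 'X_[m].
Proof.
apply/mpolyP => m'; have [le_m|nle_m] := boolP (m <= m')%MM.
  rewrite -(submK le_m) addmC mcoeff_pihomog !mcoeffMX mcoeff_pihomog.
  by rewrite mdegD addnC eqn_add2r.
have coef0 g : (g * 'X_[m])@_m' = 0.
  apply: memN_msupp_eq0; rewrite (perm_mem (msuppMX _ _)).
  by apply: contra nle_m => /mapP[m'' _ ->]; apply: lem_addr.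
by rewrite mcoeff_pihomog !coef0 if_same.
Qed.

Lemma dhomog_mdeg e f m : f \is e.-homog -> m \in msupp f -> mdeg m = e.
Proof. by move=> hf fm; apply: (dhomog_mf hf). Qed.

Lemma dhomog_mulX e f m : f \is e.-homog -> f * 'X_[m] \is (e + mdeg m).-homog.
Proof. by move=> hf; apply: dhomogM => //; rewrite dhomogX. Qed.

Lemma dhomogX1 (i : 'I_n) : ('X_i : {mpoly K[n]}) \is 1.-homog.
Proof. by rewrite dhomogX; apply/eqP/mdeg1. Qed.

(* For [k < n] these are the elements of the ideal (x_1, ..., x_k). *)
Definition in_low_vars (k : nat) f : Prop :=
  forall m, m \in msupp f -> (cls m <= k)%N.

Lemma in_low_vars_mul k f g : (k < n)%N -> in_low_vars k f -> in_low_vars k (g * f).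
Proof.
move=> lt_k fk m /msuppM_le/allpairsP[[m1 m2] /= [_ /fk cls_m2 ->]].
by rewrite addmC cls_addl.
Qed.

Lemma in_low_varsD k f g :
  in_low_vars k f -> in_low_vars k g -> in_low_vars k (f + g).
Proof.
by move=> fk gk m /msuppD_le; rewrite mem_cat => /orP[/fk|/gk].
Qed.

Lemma in_low_vars0 k : in_low_vars k 0.
Proof. by move=> m; rewrite msupp0. Qed.

Lemma gen_ideal_vars (js : seq 'I_n) f :
  (forall m, m \in msupp f -> exists2 j, j \in js & m j != 0%N) ->
  gen_ideal [seq 'X_j | j <- js] f.
Proof.
have idv := gen_ideal_is_ideal [seq ('X_j : {mpoly K[n]}) | j <- js].
move=> supp_f; rewrite [f]mpolyE big_seq; apply: (ideal_sum idv) => m fm.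
have [j js_j mj] := supp_f m fm.
rewrite -mul_mpolyC; apply: (ideal_mul idv).
have le_jm : (U_(j) <= m)%MM.
  by apply/mnm_lepP => i; rewrite mnm1E; case: eqP => // <-; rewrite lt0n.
rewrite -(submK le_jm) mpolyXD; apply: (ideal_mul idv).
by apply: gen_ideal_mem; apply: map_f.
Qed.

End MonomialSupport.

Lemma bigminnP (T : eqType) (s : seq T) (F : T -> nat) (n : nat) :
  let b := \big[minn/n]_(x <- s) F x in
  [/\ b <= n, forall x, x \in s -> b <= F x &
      b = n \/ exists2 x, x \in s & b = F x]%N.
Proof.
elim: s => [|y s [le_n le_F attained]] /=.
  by rewrite big_nil; split; [| |left].
rewrite big_cons; split=> [|x|].
- by rewrite geq_min le_n orbT.
- by rewrite inE geq_min => /orP[/eqP->|/le_F->]; rewrite ?leqnn ?orbT.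
- rewrite /minn; case: ifP => _; first by right; exists y; rewrite ?mem_head.
  case: attained => [|[x sx ->]]; [by left | right].
  by exists x; rewrite ?inE ?sx ?orbT.
Qed.

(** * The ideals I + (x_1, ..., x_k) *)

Section IdealPlusVariables.

Variables (K : fieldType) (n : nat) (I : idealr {mpoly K[n]}).
Hypothesis I_homog : homogeneous_ideal I.
Implicit Types (f g : {mpoly K[n]}) (m : 'X_{1..n}).

(** For [k < n] this is I + (x_1, ..., x_k); the part in the variables is recognised by its support,
    without cofactors. *)
Definition ideal_plus_vars (k : nat) f : Prop :=
  exists2 g, g \in I & in_low_vars k (f - g).

Lemma ideal_plus_vars_ideal k f : f \in I -> ideal_plus_vars k f.
Proof. by move=> If; exists f; rewrite // subrr; apply: in_low_vars0. Qed.

Lemma ideal_plus_vars_low k f : in_low_vars k f -> ideal_plus_vars k f.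
Proof. by exists 0; rewrite ?subr0 // idealr0. Qed.

Lemma ideal_plus_vars_is_ideal k : (k < n)%N -> is_ideal (ideal_plus_vars k).
Proof.
move=> lt_k; split=> [|a u v [g Ig ug] [g' Ig' vg']].
  exact/ideal_plus_vars_ideal/idealr0.
exists (a * g + g'); first by rewrite rpredD ?idealMr.
rewrite opprD addrACA -mulrBr; apply: in_low_varsD => //.
exact: in_low_vars_mul.
Qed.

Lemma ideal_plus_vars_pihomog k e f :
  ideal_plus_vars k f -> ideal_plus_vars k (pihomog mdeg e f).
Proof.
move=> [g Ig fg]; exists (pihomog mdeg e g); first exact: I_homog.
by rewrite -pihomogB => m /msupp_pihomog/fg.
Qed.

Lemma ideal_const_eq0 f : f \in I -> f@_0%MM = 0.
Proof.
move=> /(I_homog 0) If; apply/eqP; apply: contraFT (idealr1 I) => f0.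
by rewrite -[1]mpolyC1 -(mulVf f0) mpolyCM idealMr // -pihomog0E.
Qed.

Variable le : rel 'X_{1..n}.
Hypotheses (le_term : term_order le) (le_cls : class_respecting le).

(** In a fixed degree a class respecting order ranks larger classes higher, so the leading exponent
    has the largest class in the support. *)
Lemma lead_low_vars k e f m : f \is e.-homog -> is_lead le f m ->
  (cls m <= k)%N -> in_low_vars k f.
Proof.
move=> hf [fm max_m] le_k m' fm'; rewrite leqNgt; apply/negP => lt_k.
have /andP[ne_m le_mm'] : strict le m m'.
  by apply: le_cls; rewrite ?(dhomog_mdeg hf) //; apply: leq_ltn_trans lt_k.
case/eqP: ne_m; apply: (term_order_anti le_term).
by rewrite le_mm' max_m.
Qed.

(** The degree e component of the part of f in I agrees with f on all exponents of class above k,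
    and its other exponents are smaller than m. *)
Lemma lead_ideal_plus_vars k e f m : f \is e.-homog -> ideal_plus_vars k f ->
  is_lead le f m -> (k < cls m)%N ->
  exists g, [/\ g \in I, g \is e.-homog & is_lead le g m].
Proof.
move=> hf [g' /(I_homog e) Ig fg'] [fm max_m] lt_k.
set g := pihomog mdeg e g' in Ig; have hg : g \is e.-homog by apply: pihomogP.
have fg : in_low_vars k (f - g).
  by rewrite -(pihomog_dE hf) -pihomogB => m' /msupp_pihomog/fg'.
have suppE m' : (k < cls m')%N -> (m' \in msupp f) = (m' \in msupp g).
  move=> lt_m'; rewrite !mcoeff_msupp; congr (_ != 0).
  apply/eqP; rewrite -subr_eq0 -mcoeffB; apply: contraTT lt_m'.
  by rewrite -mcoeff_msupp -leqNgt => /fg.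
exists g; split=> //; split=> [|m' gm']; first by rewrite -suppE.
have [le_k|lt_m'] := leqP (cls m') k; last by apply: max_m; rewrite suppE.
have /andP[] // : strict le m' m.
apply: le_cls; last exact: leq_ltn_trans lt_k.
by rewrite (dhomog_mdeg hg) // (dhomog_mdeg hf).
Qed.

Variable H : seq {mpoly K[n]}.
Hypothesis H_basis : homogeneous_pommaret_basis le I H.
Variables (q d : nat).
Hypothesis q_def : q = (\max_(h <- H) (msize h).-1)%N.
Hypothesis d_def : d = \big[minn/n]_(h <- H) cls (lexp le h).

Lemma basis_ideal h : h \in H -> h \in I.
Proof. by case: H_basis => -[HI _ _ _] _ /HI[]. Qed.

Lemma basis_neq0 h : h \in H -> h != 0.
Proof. by case: H_basis => -[HI _ _ _] _ /HI[]. Qed.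

Lemma basis_is_lead h : h \in H -> is_lead le h (lexp le h).
Proof. by move=> /basis_neq0; apply: lexp_is_lead. Qed.

Lemma basis_homog h : h \in H -> h \is (mdeg (lexp le h)).-homog.
Proof.
move=> Hh; case: H_basis => _ /(_ h Hh)/homogP[e hh].
by rewrite (dhomog_mdeg hh) //; case: (basis_is_lead Hh).
Qed.

Lemma basis_deg_leq h : h \in H -> (mdeg (lexp le h) <= q)%N.
Proof.
move=> Hh; rewrite q_def.
apply: (@leq_trans (msize h).-1); last first.
  exact: (@leq_bigmax_seq _ H xpredT (fun h => (msize h).-1) h Hh isT).
have [hm _] := basis_is_lead Hh.
by rewrite -ltnS prednK ?(leq_ltn_trans _ (msize_mdeg_lt hm)) // msize_mdeg_lt.
Qed.

Lemma basis_cls h : h \in H -> (d <= cls (lexp le h))%N.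
Proof.
move=> Hh; rewrite d_def.
by case: (bigminnP H (fun h => cls (lexp le h)) n) => _ /(_ h Hh).
Qed.

Lemma ideal_lead_cone g m : g \in I -> is_lead le g m ->
  exists2 h, h \in H & pommaret_cone (lexp le h) m.
Proof.
move=> Ig lead_m; case: H_basis => -[_ _ coneE _] _; apply/coneE.
exists g; split=> //; first exact: is_lead_neq0 lead_m.
exact: is_lead_lexp.
Qed.

Lemma min_cls_attained : (exists2 f, f \in I & f != 0) ->
  exists2 h, h \in H & cls (lexp le h) = d.
Proof.
case=> f If /(lexp_is_lead le_term)/(ideal_lead_cone If)[h Hh _].
case: (bigminnP H (fun h => cls (lexp le h)) n) => _ _; rewrite -d_def.
case=> [def_d|[h' Hh' ->]]; last by exists h'.
(* The minimum is the default value n, which bounds every class, so any basis element attains it. *)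
exists h => //; apply/eqP; rewrite eqn_leq basis_cls // andbT def_d.
exact: cls_leq_n.
Qed.

(** One reduction step, for an arbitrary ideal C containing h: it serves both for I + (x_1, ...,
    x_k) and for the ideal generated by H and variables. *)
Lemma lead_reduction (C : {mpoly K[n]} -> Prop) e f h r m :
  is_ideal C -> C h -> f \is e.-homog -> is_lead le f m ->
  h \in H -> m = (lexp le h + r)%MM ->
  exists g, [/\ C g, f - g \is e.-homog &
    forall m', m' \in msupp (f - g) -> strict le m' m].
Proof.
move=> idC Ch hf lead_f Hh def_m.
have lead_hr : is_lead le (h * 'X_[r]) m.
  by rewrite def_m is_lead_mulX //; apply: basis_is_lead.
have hhr : h * 'X_[r] \is e.-homog.
  have [fm _] := lead_f; rewrite -(dhomog_mdeg hf fm) def_m mdegD.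
  exact/dhomog_mulX/basis_homog.
have [c hfc lt_fc] := lead_cancel hf hhr lead_f lead_hr.
exists (c *: (h * 'X_[r])); split=> //.
by rewrite -mul_mpolyC mulrA mulrC mulrA; apply: ideal_mul.
Qed.

Lemma lead_mul_var_cone k e f m (i : 'I_n) :
  f \is e.-homog -> is_lead le f m -> ideal_plus_vars k (f * 'X_i) ->
  (k < cls m)%N -> (k <= i)%N ->
  exists2 h, h \in H & pommaret_cone (lexp le h) (m + U_(i))%MM.
Proof.
move=> hf lead_f kfX lt_k le_ki.
have lead_fX : is_lead le (f * 'X_i) (m + U_(i))%MM by apply/is_lead_mulX.
have hfX := dhomog_mulX U_(i) hf.
have [|g [Ig _ lead_g]] := lead_ideal_plus_vars hfX kfX lead_fX.
  have lt_kn := leq_ltn_trans le_ki (ltn_ord i).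
  rewrite ltnNge; apply/negP => /(cls_leqP _ lt_kn)[j lt_j].
  rewrite mnmDE mnm1E; case: (i =P j) => [def_j|_].
    by rewrite -def_j ltnNge le_ki in lt_j.
  by rewrite addn0 => /cls_leq; rewrite leqNgt (leq_ltn_trans lt_j).
exact: ideal_lead_cone Ig lead_g.
Qed.

(* The leading exponent of [f * 'X_i] has class [i.+1] and lies in the cone of
   some basis element of class at least [d], strictly above its vertex in the
   direction [i]; hence so does the leading exponent of [f], which can be
   cancelled. *)
Lemma ideal_plus_vars_mulX e f (i : 'I_n) :
  f \is e.-homog -> (i < d)%N -> (i.+1 < d)%N || (q <= e)%N ->
  ideal_plus_vars i (f * 'X_i) -> ideal_plus_vars i f.
Proof.
move=> hf lt_id large; have idJ := ideal_plus_vars_is_ideal (ltn_ord i).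
move: f hf; apply: (homog_lead_ind le_term) => [_|f m hf lead_f IH ifX].
  exact/ideal_plus_vars_ideal/idealr0.
have [le_i|lt_i] := leqP (cls m) i.
  exact/ideal_plus_vars_low/(lead_low_vars hf lead_f).
have [h Hh [r def_m r0]] := lead_mul_var_cone hf lead_f ifX lt_i (leqnn i).
(* If h has class above i+1, its exponent at i is 0 and r supplies the factor. Otherwise its class
   is i+1 = d, so q <= e; then r_i = 0 would force r = 0 and deg h = e+1 > q. *)
have ri : r i != 0%N.
  have mi : (m + U_(i))%MM i != 0%N by rewrite mnmDE mnm1E eqxx addn1.
  have [lt_cls|le_cls_h] := ltnP i.+1 (cls (lexp le h)).
    by move: mi; rewrite def_m mnmDE (lt_cls_eq0 lt_cls).
  have cls_h : cls (lexp le h) = i.+1.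
    by apply/eqP; rewrite eqn_leq le_cls_h (leq_trans lt_id) ?basis_cls.
  move: large; rewrite ltnNge -{1}cls_h basis_cls //= => le_qe.
  apply: contraL le_qe => /eqP ri; rewrite -ltnNge.
  have r_eq0 : r = 0%MM.
    apply/mnmP => j; rewrite mnm0E; case: (ltngtP j i) => [lt_j|lt_j|/val_inj->//].
      have := congr1 (fun m' : 'X_{1..n} => m' j) def_m; rewrite !mnmDE mnm1E.
      rewrite lt_cls_eq0 ?(leq_trans _ lt_i) // [i == j]eq_sym -val_eqE /=.
      rewrite (ltn_eqF lt_j).
      by move/esym/eqP; rewrite addn_eq0 => /andP[_ /eqP].
    by apply: r0; rewrite cls_h.
  apply: leq_trans (basis_deg_leq Hh).
  have [fm _] := lead_f; have := congr1 mdeg def_m.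
  by rewrite r_eq0 addm0 mdegD mdeg1 (dhomog_mdeg hf fm) addn1 => <-.
have le_ir : (U_(i) <= r)%MM.
  by apply/mnm_lepP => j; rewrite mnm1E; case: eqP => // <-; rewrite lt0n.
have {}def_m : m = (lexp le h + (r - U_(i)))%MM.
  by apply: (@addIm _ U_(i)%MM); rewrite def_m -addmA submK.
have [g [Ig hfg lt_fg]] :=
  lead_reduction idJ (ideal_plus_vars_ideal i (basis_ideal Hh)) hf lead_f Hh def_m.
rewrite -(subrK g f); apply: ideal_add => //; apply: IH => //.
by rewrite mulrBl; apply: ideal_sub => //; rewrite mulrC; apply: ideal_mul.
Qed.

Lemma ideal_plus_vars_mulX_inhomog f (i : 'I_n) : (i.+1 < d)%N ->
  ideal_plus_vars i (f * 'X_i) -> ideal_plus_vars i f.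
Proof.
move=> lt_id ifX; rewrite [f](pihomog_partitionE (leqnn (msize f))).
apply: ideal_sum => [|e _]; first exact: ideal_plus_vars_is_ideal.
apply: (@ideal_plus_vars_mulX e); rewrite ?lt_id ?(ltnW lt_id) ?pihomogP //.
by rewrite -pihomog_mulX; apply: ideal_plus_vars_pihomog.
Qed.

(** * Socle and growth modulo x_1, ..., x_(d-1) *)

Section MinimalClass.

(** From here on ['X_i] is x_d and [ideal_plus_vars i] is J = I + (x_1, ..., x_(d-1)). *)
Variable i : 'I_n.
Hypothesis d_i : d = i.+1.

(* Modulo x_1, ..., x_{d-1}, a basis element of class d is divisible by x_d;
   the quotient is not in the ideal because cones are disjoint. *)
Lemma socle_candidate (I_neq0 : exists2 f, f \in I & f != 0) :
  exists e f, [/\ f \is e.-homog, ideal_plus_vars i (f * 'X_i) &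
    ~ ideal_plus_vars i f].
Proof.
have [h Hh cls_h] := min_cls_attained I_neq0; set mu := lexp le h in cls_h.
have lead_h : is_lead le h mu by apply: basis_is_lead.
have [h_mu max_mu] := lead_h.
(* The terms of h outside (x_1, ..., x_(d-1)), divided by x_d. *)
pose f := \sum_(m <- msupp h | (i < cls m)%N) h@_m *: 'X_[m - U_(i)].
have i_le m : m \in msupp h -> (i < cls m)%N -> (U_(i) <= m)%MM.
  move=> hm lt_m; apply/mnm_lepP => j; rewrite mnm1E; case: eqP => // <-{j}.
  have m_neq0 : m != 0%MM.
    apply: contraTneq hm => ->; rewrite mcoeff_msupp ideal_const_eq0 ?eqxx //.
    exact: basis_ideal.
  (* A term of class above d would exceed the leading exponent, so the surviving terms have class
     exactly d and contain x_d. *)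
  have le_m : (cls m <= i.+1)%N.
    rewrite -d_i -cls_h leqNgt; apply/negP => lt_mu.
    have /andP[ne_mu le_mu] : strict le mu m.
      by apply: le_cls => //; rewrite (dhomog_mdeg (basis_homog Hh) hm).
    case/eqP: ne_mu; apply: (term_order_anti le_term).
    by rewrite le_mu max_mu.
  have [j cls_m mj] := cls_witness m_neq0.
  suff <- : j = i by rewrite lt0n.
  apply/val_inj/eqP; rewrite eqn_leq; rewrite cls_m in le_m lt_m.
  by rewrite -ltnS le_m -ltnS lt_m.
have fX : f * 'X_i = \sum_(m <- msupp h | (i < cls m)%N) h@_m *: 'X_[m].
  rewrite mulr_suml big_seq_cond [RHS]big_seq_cond.
  apply: eq_bigr => m /andP[hm lt_m].
  by rewrite -scalerAl -mpolyXD submK // i_le.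
have fX_coef m : (f * 'X_i)@_m = if (i < cls m)%N then h@_m else 0.
  by rewrite fX mcoeff_filter.
have lead_f : is_lead le f (mu - U_(i))%MM.
  apply/(is_lead_mulX le_term _ _ U_(i)%MM).
  rewrite submK; last by rewrite i_le ?cls_h ?d_i.
  split=> [|m]; rewrite mcoeff_msupp fX_coef.
    by rewrite cls_h d_i ltnSn -mcoeff_msupp.
  by case: ifP => _; rewrite ?eqxx // -mcoeff_msupp => /max_mu.
have hf : f \is (mdeg mu).-1.-homog.
  apply/dhomogP => m; rewrite mcoeff_msupp -(mcoeffMX f U_(i)%MM) fX_coef.
  case: ifP; rewrite ?eqxx // -mcoeff_msupp => _ /(dhomog_mdeg (basis_homog Hh)).
  by rewrite mdegD mdeg1 => <-.
exists (mdeg mu).-1, f; split=> //.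
- exists h; first exact: basis_ideal.
  move=> m; rewrite mcoeff_msupp mcoeffB fX_coef.
  by case: ltnP => // _; rewrite subrr eqxx.
(* If f were in J, mu - U_i would lie in the cone of some h'. As h' has class at least d, mu would
   lie there too, and h' differs from h by degree: a contradiction to disjointness. *)
- move=> /(lead_ideal_plus_vars hf)/(_ lead_f)[|g [Ig _ lead_g]].
    by apply: (ltn_cls_sub (ltn_ord i) (lem_subr _ _)); rewrite cls_h d_i.
  have [h' Hh' [r def_r r0]] := ideal_lead_cone Ig lead_g.
  have le_i : (U_(i) <= mu)%MM by rewrite i_le ?cls_h ?d_i.
  case: H_basis => -[_ _ _ disj] _; apply: (disj h h' mu) => //.
    apply/eqP => def_h; have := congr1 mdeg def_r; rewrite -def_h -/mu.
    have := congr1 mdeg (submK le_i); rewrite !mdegD mdeg1 => <-.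
    by rewrite addn1 addSn => /eqP; rewrite ltn_eqF // ltnS leq_addr.
  split; first by exists 0%MM; rewrite ?addm0 // => j _; rewrite mnm0E.
  exists (r + U_(i))%MM; first by rewrite addmA -def_r submK.
  move=> j lt_j; rewrite mnmDE r0 // mnm1E; case: eqP => // def_j.
  by move: lt_j; rewrite -def_j -d_i ltnNge basis_cls.
Qed.

(* (J : x_d) / J vanishes in degrees at least q, so its elements of maximal
   degree are annihilated by all variables. *)
Lemma socle_exists (I_neq0 : exists2 f, f \in I & f != 0) :
  exists2 f, ~ ideal_plus_vars i f & forall j, ideal_plus_vars i (f * 'X_j).
Proof.
have idJ := ideal_plus_vars_is_ideal (ltn_ord i).
have [e [f [hf ifX nif]]] := socle_candidate I_neq0.
(* Multiply by a variable as long as the product stays outside J; the degree remains bounded in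
   terms of q. *)
have [N] := ubnP (q - e); elim: N e f hf ifX nif => // N IHN e f hf ifX nif.
rewrite ltnS => le_N.
have [socle|/boolp.existsNP[j nifj]] :=
  boolp.EM (forall j, ideal_plus_vars i (f * 'X_j)).
  by exists f.
have hfj : f * 'X_j \is (e.+1).-homog.
  by have := dhomog_mulX U_(j)%MM hf; rewrite mdeg1 addn1.
have ifjX : ideal_plus_vars i (f * 'X_j * 'X_i).
  by rewrite mulrAC mulrC; apply: ideal_mul.
apply: (IHN e.+1 (f * 'X_j)) => //; apply: leq_trans le_N.
rewrite ltn_sub2l // ltnNge; apply/negP => le_qe; apply: nifj.
apply: ideal_plus_vars_mulX hfj _ _ ifjX; rewrite ?d_i //.
by rewrite (leq_trans le_qe) ?orbT.
Qed.

Lemma low_vars_gen_ideal f : in_low_vars i f ->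
  gen_ideal [seq 'X_j | j : 'I_n <- enum 'I_n & (j.+1 < d)%N] f.
Proof.
move=> fi; apply: gen_ideal_vars => m /fi /(cls_leqP _ (ltn_ord i))[j lt_j mj].
by exists j; rewrite // mem_filter mem_enum d_i ltnS lt_j.
Qed.

(* Quasi-stability: once x_d^k m is a leading exponent, the basis element whose
   cone contains it already divides m. *)
Lemma basis_divides m k h r : mdeg m = q -> (i < cls m)%N -> h \in H ->
  (U_(i) *+ k + m)%MM = (lexp le h + r)%MM ->
  (forall j : 'I_n, (cls (lexp le h) < j.+1)%N -> r j = 0%N) ->
  (lexp le h <= m)%MM.
Proof.
move=> deg_m lt_m Hh def_m r0; set mu := lexp le h in def_m r0 *.
have sum_off j : j != i -> (m j = mu j + r j)%N.
  move=> ne_j; have := congr1 (fun m' : 'X_{1..n} => m' j) def_m.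
  by rewrite !mnmDE mulmnE mnm1E eq_sym (negPf ne_j).
apply/mnm_lepP => j; have [->{j}|/sum_off->] := eqVneq j i; last exact: leq_addr.
have [lt_cls|le_cls_h] := ltnP i.+1 (cls mu); first by rewrite (lt_cls_eq0 lt_cls).
(* Below i both exponents vanish, above i the cone condition applies. So mu and m differ at i only,
   where deg mu <= q = deg m decides. *)
have eq_off j : j != i -> mu j = m j.
  move=> ne_j; suff r_j : r j = 0%N by rewrite sum_off // r_j addn0.
  have [lt_j|lt_j|/val_inj def_j] := ltngtP j i; last by rewrite def_j eqxx in ne_j.
    have := sum_off j ne_j; rewrite (lt_cls_eq0 (leq_ltn_trans lt_j lt_m)).
    by move/esym/eqP; rewrite addn_eq0 => /andP[_ /eqP].
  by apply: r0; apply: leq_ltn_trans le_cls_h _.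
have := basis_deg_leq Hh.
rewrite -deg_m !mdegE (bigD1 i) //= [in leqRHS](bigD1 i) //=.
by rewrite (eq_bigr m) ?leq_add2r.
Qed.

(** A power of x_d in J is the leading monomial of some g in I. For a leading exponent m of degree q
    and class at least d, the exponent of x_d^k m is thus a leading exponent of I, and
    [basis_divides] allows m to be cancelled. *)
Lemma gen_ideal_of_power k : ideal_plus_vars i ('X_i ^+ k) ->
  forall f, f \is q.-homog ->
  gen_ideal (H ++ [seq 'X_j | j : 'I_n <- enum 'I_n & (j.+1 < d)%N]) f.
Proof.
move=> Xk; set G := _ ++ _; have idG := gen_ideal_is_ideal G.
have hXk : ('X_i ^+ k : {mpoly K[n]}) \is k.-homog.
  by rewrite mpolyXn dhomogX; apply/eqP; rewrite /= mdegMn mdeg1 mul1n.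
have lead_Xk : is_lead le ('X_i ^+ k : {mpoly K[n]}) (U_(i) *+ k)%MM.
  rewrite mpolyXn; split=> [|m]; rewrite msuppX inE // => /eqP->.
  exact: term_order_refl.
have [|g [Ig _ lead_g]] := lead_ideal_plus_vars hXk Xk lead_Xk.
  rewrite ltnNge; apply/negP => /(cls_leqP _ (ltn_ord i))[j lt_j].
  by rewrite mulmnE mnm1E -val_eqE /= (gtn_eqF lt_j).
apply: (homog_lead_ind le_term) => [|f m hf lead_f IH]; first by case: idG.
have [le_i|lt_i] := leqP (cls m) i.
  apply: gen_ideal_sub (low_vars_gen_ideal (lead_low_vars hf lead_f le_i)) => p.
  by rewrite mem_cat orbC => ->.
have deg_m : mdeg m = q by have [fm _] := lead_f; rewrite (dhomog_mdeg hf fm).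
have Igm : g * 'X_[m] \in I by rewrite mulrC idealMr.
have lead_gm : is_lead le (g * 'X_[m]) (U_(i) *+ k + m)%MM by apply/is_lead_mulX.
have [h Hh [r def_m r0]] := ideal_lead_cone Igm lead_gm.
have le_hm := basis_divides deg_m lt_i Hh def_m r0.
have Gh : gen_ideal G h by apply: gen_ideal_mem; rewrite mem_cat Hh.
have [|p [Gp hfp lt_fp]] :=
  lead_reduction (r := (m - lexp le h)%MM) idG Gh hf lead_f Hh.
  by rewrite addmC submK.
by rewrite -(subrK p f); apply: ideal_add => //; apply: IH.
Qed.

(* Total exponent of x_d, ..., x_n. *)
Definition high_deg (m : 'X_{1..n}) : nat := (\sum_(j : 'I_n | (i <= j)%N) m j)%N.

Lemma high_degD m1 m2 : high_deg (m1 + m2)%MM = (high_deg m1 + high_deg m2)%N.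
Proof. by rewrite -big_split; apply: eq_bigr => j _; rewrite mnmDE. Qed.

Lemma high_deg_lt m : (cls m <= i)%N -> (high_deg m < mdeg m)%N.
Proof.
move=> /(cls_leqP _ (ltn_ord i))[j lt_j mj].
rewrite mdegE (bigD1 j) //= -add1n leq_add ?lt0n //.
rewrite /high_deg big_mkcond [leqRHS]big_mkcond; apply: leq_sum => l _.
by case: (eqVneq l j) => [->|_]; [rewrite [(i <= j)%N]leqNgt lt_j | case: ifP].
Qed.

(** Equality of [mdeg r] and [high_deg r] says that r involves only x_d, ..., x_n. *)
Lemma submonomial_of_deg (m : 'X_{1..n}) e : (e <= high_deg m)%N ->
  exists2 r : 'X_{1..n}, (r <= m)%MM & mdeg r = e /\ high_deg r = e.
Proof.
elim: e => [|e IHe] lt_e.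
  exists 0%MM; first by apply/mnm_lepP => j; rewrite mnm0E.
  by rewrite mdeg0 /high_deg big1 // => j _; rewrite mnm0E.
have [r le_r [deg_r high_r]] := IHe (ltnW lt_e).
have [j /andP[le_ij lt_j]] : exists j : 'I_n, (i <= j)%N && (r j < m j)%N.
  apply/existsP; apply: contraLR lt_e; rewrite negb_exists -leqNgt => /forallP ge_r.
  rewrite -high_r; apply: leq_sum => j le_ij.
  by have := ge_r j; rewrite le_ij -leqNgt.
exists (r + U_(j))%MM.
  apply/mnm_lepP => l; rewrite mnmDE mnm1E; case: eqP => [<-|_]; rewrite ?addn1 //.
  by rewrite addn0; apply/mnm_lepP.
rewrite mdegD mdeg1 deg_r high_degD high_r /high_deg (bigD1 j) //= mnm1E eqxx big1.
  by rewrite addn1.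
by move=> l /andP[_ ne_l]; rewrite mnm1E eq_sym (negPf ne_l).
Qed.

Definition spanned_by (S : pred 'X_{1..n}) f : Prop :=
  exists2 g, f - g \in I & forall m, m \in msupp g -> S m.

Lemma spanned_by_monomials (S : pred 'X_{1..n}) f :
  (forall m, m \in msupp f -> spanned_by S 'X_[m]) -> spanned_by S f.
Proof.
move=> span_m; rewrite [f]mpolyE big_seq.
apply: (big_ind (spanned_by S)) => [|f1 f2 [g1 I1 S1] [g2 I2 S2]|m /span_m[g Ig Sg]].
- by exists 0; rewrite ?subrr ?idealr0 // => m; rewrite msupp0.
- exists (g1 + g2); first by rewrite opprD addrACA rpredD.
  by move=> m /msuppD_le; rewrite mem_cat => /orP[/S1|/S2].
exists (f@_m *: g); last by move=> m' /msuppZ_le/Sg.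
by rewrite -scalerBr -mul_mpolyC idealMr.
Qed.

Hypothesis degree_q : forall m, mdeg m = q -> ideal_plus_vars i 'X_[m].

(** A factor of degree q in x_d, ..., x_n is congruent modulo I to a form of degree q in (x_1, ...,
    x_(d-1)). Substituting it keeps the total degree and lowers [high_deg]. *)
Lemma monomial_spanned m :
  spanned_by (fun m' => (mdeg m' <= mdeg m)%N && (high_deg m' < q)%N) 'X_[m].
Proof.
have [N] := ubnP (high_deg m); elim: N m => // N IHN m; rewrite ltnS => le_N.
have [lt_q|le_q] := ltnP (high_deg m) q.
  exists 'X_[m]; rewrite ?subrr ?idealr0 // => m'.
  by rewrite msuppX inE => /eqP->; rewrite leqnn.
have [r le_rm [deg_r high_r]] := submonomial_of_deg le_q.
have [g' /(I_homog q) Ig low_g'] := degree_q deg_r.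
set g := pihomog mdeg q g' in Ig.
have hXr : ('X_[r] : {mpoly K[n]}) \is q.-homog by rewrite dhomogX; apply/eqP.
have low_g : in_low_vars i ('X_[r] - g).
  by rewrite -(pihomog_dE hXr) -pihomogB => m' /msupp_pihomog/low_g'.
have hg : 'X_[r] - g \is q.-homog by rewrite rpredB ?pihomogP.
have [|p Ip Sp] := @spanned_by_monomials
    (fun m' => (mdeg m' <= mdeg m)%N && (high_deg m' < q)%N)
    (('X_[r] - g) * 'X_[m - r]).
  move=> m'; rewrite (perm_mem (msuppMX _ _)) => /mapP[s supp_s ->].
  have [deg_s low_s] := (dhomog_mdeg hg supp_s, low_g s supp_s).
  have deg_m : mdeg m = (mdeg (m - r)%MM + q)%N.
    by rewrite -{1}(submK le_rm) mdegD deg_r.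
  have high_m : high_deg m = (high_deg (m - r)%MM + q)%N.
    by rewrite -{1}(submK le_rm) high_degD high_r.
  have lt_s := high_deg_lt low_s; rewrite deg_s in lt_s.
  have [|p Ip Sp] := IHN ((m - r) + s)%MM.
    by apply: leq_trans le_N; rewrite high_degD high_m ltn_add2l.
  by exists p => // m'' /Sp; rewrite mdegD deg_s -deg_m.
exists p => //; rewrite -(subrK (('X_[r] - g) * 'X_[m - r]) 'X_[m]) -addrA rpredD //.
by rewrite mulrBl -mpolyXD [(r + _)%MM]addmC submK // subKr mulrC idealMr.
Qed.

(** Counts the spanning monomials of degree at most e: the exponents of x_d, ..., x_n are below q,
    the d-1 others at most e. *)
Lemma quotient_growth e : exists (T : finType) (g : T -> {mpoly K[n]}),
  (#|T| <= q ^ n * e.+1 ^ i)%N /\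
  forall f, deg_le e f ->
    exists c : T -> K, f - \sum_t c t *: g t \in I.
Proof.
pose A : {pred 'X_{1..n < e.+1}} := fun b => (high_deg (bmnm b) < q)%N.
exists {b in A}, (fun b => 'X_[bmnm (val b)]); split; last first.
  move=> f fe; pose S m := (mdeg m <= e)%N && (high_deg m < q)%N.
  have [m fm|g Ig Sg] := @spanned_by_monomials S f.
    have [g Ig Sg] := monomial_spanned m; exists g => // m' /Sg/andP[le_m' lt_m'].
    by rewrite /S lt_m' (leq_trans le_m') ?fe.
  exists (fun b => g@_(bmnm (val b))).
  suff <- : g = \sum_(b : {b in A}) g@_(bmnm (val b)) *: 'X_[bmnm (val b)] by [].
  rewrite -(@big_sub _ _ _ _ A (fun b => g@_(bmnm b) *: 'X_[bmnm b])).
  rewrite {1}[g](mpolywE (k := e.+1)); last first.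
    by rewrite mmeasureE; apply/bigmax_leqP_seq => m /Sg/andP[].
  rewrite [RHS]big_mkcond; apply: eq_bigr => b _; case: ifP => // /negbT nA.
  rewrite memN_msupp_eq0 ?scale0r //; apply: contra nA => /Sg/andP[_ lt_b].
  by rewrite unfold_in.
(* For q = 0 no exponent qualifies and the family is empty; [code] needs q positive. *)
have [q0|q_gt0] := posnP q.
  by rewrite eq_card0 // => b; have := valP b; rewrite unfold_in /= q0.
case: q q_gt0 @A => // q' _ A.
pose code (b : {b in A}) : {ffun 'I_n -> 'I_q'.+1} * {ffun 'I_i -> 'I_e.+1} :=
  ([ffun j : 'I_n => if (i <= j)%N then inord (bmnm (val b) j) else ord0],
   [ffun j : 'I_i => inord (bmnm (val b) (widen_ord (ltnW (ltn_ord i)) j))]).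
have mem_le m (j : 'I_n) : (m j <= mdeg m)%N by rewrite mdegE (bigD1 j) //= leq_addr.
have inj_code : injective code.
  move=> b1 b2 [/ffunP eq_high /ffunP eq_low]; apply/val_inj/val_inj/mnmP => j /=.
  have lt_e (b : {b in A}) (l : 'I_n) : (bmnm (val b) l < e.+1)%N.
    exact: leq_ltn_trans (mem_le _ _) (bmdeg (val b)).
  have lt_q (b : {b in A}) (l : 'I_n) : (i <= l)%N -> (bmnm (val b) l < q'.+1)%N.
    move=> le_l; apply: leq_ltn_trans (valP b).
    by rewrite /high_deg (bigD1 l) //= leq_addr.
  have [lt_j|le_j] := ltnP j i.
    have := congr1 val (eq_low (Ordinal lt_j)); rewrite !ffunE /= !inordK ?lt_e //.
    by have -> : widen_ord (ltnW (ltn_ord i)) (Ordinal lt_j) = j by apply: val_inj.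
  by have := congr1 val (eq_high j); rewrite !ffunE le_j /= !inordK ?lt_q.
apply: leq_trans (leq_card code inj_code) _.
by rewrite card_prod !card_ffun !card_ord.
Qed.

End MinimalClass.

End IdealPlusVariables.

(** * The quotient algebra *)

Section QuotientRing.

#[local] Open Scope quotient_scope.

Variables (K : fieldType) (n : nat) (I : idealr {mpoly K[n]}).
Hypothesis I_homog : homogeneous_ideal I.
Implicit Types (f g : {mpoly K[n]}).

Local Notation quo := (\pi_({ideal_quot I})).

Lemma quo_eqP f g : quo f = quo g <-> f - g \in I.
Proof. by rewrite Quotient.idealrBE; split=> [/eqP|/eqP]. Qed.

Lemma quo_surj (a : {ideal_quot I}) : exists f, quo f = a.
Proof. by exists (repr a); rewrite reprK. Qed.

Lemma gen_ideal_quo (s : seq {mpoly K[n]}) f :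
  gen_ideal [seq quo p | p <- s] (quo f) <->
  exists2 g, g \in I & gen_ideal s (f - g).
Proof.
have ids := gen_ideal_is_ideal s.
have idqs := gen_ideal_is_ideal [seq quo p | p <- s].
split=> [|[g Ig]].
  have: forall a, gen_ideal [seq quo p | p <- s] a ->
      exists2 p, a = quo p & gen_ideal s p.
    apply: gen_ideal_min => [|_ /mapP[p sp ->]]; last first.
      by exists p => //; apply: gen_ideal_mem.
    split=> [|a _ _ [p -> sp] [p' -> sp']].
      by exists 0; rewrite ?rmorph0 //; case: ids.
    have [c <-] := quo_surj a; exists (c * p + p').
      by rewrite rmorphD rmorphM.
    by case: ids => _; apply.
  move=> ex_p /ex_p[p /quo_eqP Ifp sp]; exists (f - p) => //.
  by rewrite subKr.
have -> : quo f = quo (f - g) by apply/quo_eqP; rewrite subKr.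
move: {f Ig}(f - g); apply: gen_ideal_min => [|p sp]; last first.
  exact/gen_ideal_mem/map_f.
split=> [|a u v su sv]; first by rewrite rmorph0; case: idqs.
by rewrite rmorphD rmorphM; case: idqs => _; apply.
Qed.

Lemma in_take_enum k (j : 'I_n) : (j \in take k (enum 'I_n)) = (j < k)%N.
Proof. by rewrite in_take ?mem_enum // index_enum_ord. Qed.

Lemma gen_ideal_quo_vars k f : (k < n)%N ->
  gen_ideal [seq quo 'X_j | j <- take k (enum 'I_n)] (quo f) <->
  ideal_plus_vars I k f.
Proof.
move=> lt_k; rewrite (map_comp quo (fun j => 'X_j)).
apply: iff_trans (gen_ideal_quo _ _) _; split=> -[g Ig fg]; exists g => //.
  move: (f - g) fg; apply: gen_ideal_min => [|_ /mapP[j + ->]].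
    split=> [|a u v uk vk]; first exact: in_low_vars0.
    by apply: in_low_varsD => //; apply: in_low_vars_mul.
  rewrite in_take_enum => lt_j m; rewrite msuppX inE => /eqP->.
  by apply/(cls_leqP _ lt_k); exists j; rewrite ?mnm1E ?eqxx.
apply: gen_ideal_vars => m /fg/(cls_leqP _ lt_k)[j lt_j mj].
by exists j; rewrite ?in_take_enum.
Qed.

(** Supplies the hypothesis of the Koszul argument that the regular sequence lies in the ideal of
    the variables. *)
Lemma quo_pos_homog_vars (a : {ideal_quot I}) : quot_pos_homog a ->
  exists e : 'I_n -> {ideal_quot I}, a = \sum_j e j * quo 'X_j.
Proof.
move=> [e [f [e_gt0 hf] ->]].
have: gen_ideal [seq 'X_j | j <- enum 'I_n] f.
  apply: gen_ideal_vars => m fm; have := dhomog_mdeg hf fm.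
  move=> deg_m; have [|j _ mj] := @cls_witness _ m.
    by rewrite -mdeg_eq0 deg_m -lt0n.
  by exists j; rewrite ?mem_enum.
move: f {hf}; apply: gen_ideal_min => [|_ /mapP[j _ ->]].
  split=> [|c u v [eu def_u] [ev def_v]].
    by exists (fun=> 0); rewrite rmorph0 big1 // => j _; rewrite mul0r.
  exists (fun j => quo c * eu j + ev j).
  rewrite rmorphD rmorphM /= def_u def_v mulr_sumr -big_split /=.
  by apply: eq_bigr => j _; rewrite mulrDl mulrA.
exists (fun l => (l == j)%:R); rewrite (bigD1 j) //= eqxx mul1r big1 ?addr0 //.
by move=> l /negPf->; rewrite mul0r.
Qed.

(** The constant term is well defined modulo I, which is proper and homogeneous, and is
    multiplicative with values in a field. *)
Lemma irrelevant_prime :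
  exists Q : prime_idealr {ideal_quot I}, forall f, quo f \in Q <-> f@_0%MM = 0.
Proof.
pose P (a : {ideal_quot I}) := exists2 f, a = quo f & f@_0%MM = 0.
have PE f : P (quo f) <-> f@_0%MM = 0.
  split=> [[g /quo_eqP/(ideal_const_eq0 I_homog)]|f0]; last by exists f.
  by rewrite mcoeffB => /subr0_eq ->.
have [||a b|Q QE] := @prime_idealr_of_predicate _ P.
- split=> [|a _ _ [f -> f0] [g -> g0]]; first by exists 0; rewrite ?rmorph0 ?mcoeff0.
  have [c <-] := quo_surj a; exists (c * f + g); first by rewrite rmorphD rmorphM.
  by rewrite mcoeffD rmorphM /= f0 g0 mulr0 addr0.
- rewrite -(rmorph1 quo) => /PE/eqP.
  by rewrite mcoeff1 eqxx oner_eq0.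
- have [[f <-] [g <-]] := (quo_surj a, quo_surj b).
  rewrite -rmorphM => /PE/eqP; rewrite rmorphM mulf_eq0.
  by case/orP => /eqP f0; [left | right]; apply/PE.
by exists Q => f; exact: iff_trans (QE _) (PE _).
Qed.

End QuotientRing.

(** * Depth and dimension of P/I *)

Section PommaretQuotient.

#[local] Open Scope quotient_scope.

Variables (K : fieldType) (n : nat) (I : idealr {mpoly K[n]}).
Hypothesis I_homog : homogeneous_ideal I.
Hypothesis I_neq0 : exists2 f : {mpoly K[n]}, f \in I & f != 0.
Variable le : rel 'X_{1..n}.
Hypotheses (le_term : term_order le) (le_cls : class_respecting le).
Variable H : seq {mpoly K[n]}.
Hypothesis H_basis : homogeneous_pommaret_basis le I H.
Variables q d : nat.
Hypothesis q_def : q = (\max_(h <- H) (msize h).-1)%N.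
Hypothesis d_def : d = \big[minn/n]_(h <- H) cls (lexp le h).

Local Notation quo := (\pi_({ideal_quot I})).

(** No leading exponent in H is 0, as I contains no nonzero constant; hence the minimal class
    belongs to a variable. *)
Lemma min_cls_ord : exists i : 'I_n, d = i.+1.
Proof.
have [h Hh cls_h] := min_cls_attained le_term H_basis d_def I_neq0.
have [|i def_i _] := @cls_witness _ (lexp le h); last by exists i; rewrite -cls_h.
apply/eqP => lex0; have := basis_is_lead le_term H_basis Hh => -[].
rewrite lex0 mcoeff_msupp (ideal_const_eq0 I_homog) ?eqxx //.
exact: basis_ideal H_basis _ Hh.
Qed.

Variable i : 'I_n.
Hypothesis d_i : d = i.+1.

Definition first_vars : seq {ideal_quot I} :=
  [seq quo 'X_j | j <- take i (enum 'I_n)].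

Lemma size_first_vars : size first_vars = i.
Proof. by rewrite size_map size_takel // size_enum_ord ltnW. Qed.

Lemma first_vars_regular : regular_seq first_vars.
Proof.
split=> [l b|].
  have lt_l : (l < i)%N by rewrite -size_first_vars.
  have lt_ln := ltn_trans lt_l (ltn_ord i).
  have [f <-] := quo_surj b.
  rewrite /first_vars -map_take take_takel ?(ltnW lt_l) //.
  rewrite (nth_map (Ordinal lt_ln)) ?nth_take ?size_takel ?size_enum_ord //;
    last exact: ltnW.
  rewrite -[nat_of_ord l]/(nat_of_ord (Ordinal lt_ln)) nth_ord_enum -rmorphM.
  rewrite mulrC => /(gen_ideal_quo_vars I _ lt_ln) fX.
  apply/(gen_ideal_quo_vars I _ lt_ln).
  apply: (ideal_plus_vars_mulX_inhomog I_homog le_term le_cls H_basis q_def d_def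
    (i := Ordinal lt_ln)) => //.
  by rewrite d_i ltnS.
rewrite -(rmorph1 quo) => /(gen_ideal_quo_vars I _ (ltn_ord i))[g Ig low_g].
have := low_g 0%MM; rewrite mcoeff_msupp mcoeffB mcoeff1 eqxx.
rewrite (ideal_const_eq0 I_homog Ig) subr0 oner_eq0 => /(_ isT).
by rewrite /cls eqxx leqNgt ltn_ord.
Qed.

Lemma first_vars_pos_homog a : a \in first_vars -> quot_pos_homog a.
Proof.
by case/mapP => j _ ->; exists 1%N, 'X_j; [split; [|apply: dhomogX1] | ].
Qed.

(** A longer sequence would force the socle element of P/J into J. *)
Lemma regular_seq_leq (s : seq {ideal_quot I}) : regular_seq s ->
  (forall a, a \in s -> quot_pos_homog a) -> (size s <= i)%N.
Proof.
move=> [reg_s _] pos_s; rewrite leqNgt; apply/negP => lt_is.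
have [f nif socle] :=
  socle_exists I_homog le_term le_cls H_basis q_def d_def d_i I_neq0.
apply/nif/(gen_ideal_quo_vars I _ (ltn_ord i)).
have [reg_vars _] := first_vars_regular.
apply: (socle_mod_short_regular_seq (x := fun j : 'I_n => quo 'X_j) reg_vars reg_s).
- by rewrite size_first_vars.
- by move=> a /pos_s; apply: quo_pos_homog_vars.
- move=> j; rewrite -rmorphM mulrC.
  by apply/(gen_ideal_quo_vars I _ (ltn_ord i)).
Qed.

Lemma prime_chain_of_no_power :
  (forall k, ~ ideal_plus_vars I i ('X_i ^+ k)) ->
  prime_chain {ideal_quot I} i.+1.
Proof.
move=> no_power; have [Q QE] := irrelevant_prime I_homog.
have idV := gen_ideal_is_ideal first_vars.
have idJ := ideal_plus_vars_is_ideal I (ltn_ord i).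
have [a|k b|p [vars_p pQ p_i]] :=
  @smaller_prime _ (gen_ideal first_vars) Q (quo 'X_i) idV.
- move: a; apply: gen_ideal_min => [|_ /mapP[j _ ->]].
    split=> [|a u v Qu Qv]; first exact: idealr0.
    by rewrite rpredD // idealMr.
  by apply/QE; rewrite mcoeffX mnm1_eq0.
(* The degree k component of f x_d^k is the constant term of f times x_d^k. It lies in J with f
   x_d^k, so the constant term is 0. *)
- have [f <-] := quo_surj b; rewrite -rmorphXn -rmorphM.
  move=> /(gen_ideal_quo_vars I _ (ltn_ord i)); rewrite mulrC mpolyXn.
  move=> /(ideal_plus_vars_pihomog I_homog (0 + mdeg (U_(i) *+ k)%MM)).
  rewrite pihomog_mulX pihomog0E => fX; apply/QE/eqP; apply: contraT => f0.
  case: (no_power k); rewrite mpolyXn -[X in ideal_plus_vars _ _ X]mul1r.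
  by rewrite -mpolyC1 -(mulVf f0) mpolyCM -mulrA; apply: ideal_mul.
have [reg_vars _] := first_vars_regular.
have := regular_seq_chain_below reg_vars vars_p; rewrite size_first_vars => chain_p.
apply: prime_chain_of_chain_below (chain_belowS chain_p pQ _ p_i).
by apply/QE; rewrite mcoeffX mnm1_eq0.
Qed.

Lemma prime_chain_leq l :
  (forall m, mdeg m = q -> ideal_plus_vars I i 'X_[m]) ->
  prime_chain {ideal_quot I} l -> (l <= i)%N.
Proof.
move=> deg_q chain_l.
apply: (chain_length_le (@quo_surj K n I) (N := (q ^ n)%N) _ chain_l) => e.
 have [T [g [cardT span_g]]] := quotient_growth I_homog deg_q e.
by exists T, g; split=> // f /span_g[c /quo_eqP]; exists c.
Qed.

End PommaretQuotient.

(** * The Cohen-Macaulay criterion *)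

Theorem theorem3p17 (K : fieldType) (n : nat) (I : idealr {mpoly K[n]})
    (I_neq0 : exists2 f : {mpoly K[n]}, f \in I & f != 0)
    (I_homog : homogeneous_ideal I)
    (le : rel 'X_{1..n})
    (le_term : term_order le) (le_cls : class_respecting le)
    (H : seq {mpoly K[n]})
    (H_basis : homogeneous_pommaret_basis le I H)
    (q d : nat)
    (q_def : q = (\max_(h <- H) (msize h).-1)%N)
    (d_def : d = \big[minn/n]_(h <- H) cls (lexp le h)) :
  cohen_macaulay_quot I <->
  (forall f : {mpoly K[n]},
     hcomp (gen_ideal (H ++ [seq 'X_i | i : 'I_n <- enum 'I_n & (i.+1 < d)%N])) q f <->
     f \is q.-homog).
Proof.
have [i d_i] := min_cls_ord I_homog I_neq0 le_term H_basis d_def.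
have d_n : (i < n)%N := ltn_ord i.
split=> [[m [[depth_m max_m] [dim_m max_dim]]] f|cond].
  split=> [[]//|hf]; split=> //; move: f hf.
  have [[k Xk]|no_power] := boolp.EM (exists k, ideal_plus_vars I i ('X_i ^+ k)).
    exact: (gen_ideal_of_power I_homog le_term le_cls H_basis q_def d_i Xk).
  (* Without such a power, the dimension is at least d, while the socle bounds the depth by d-1. *)
  have /max_dim : prime_chain {ideal_quot I} i.+1.
    apply: (prime_chain_of_no_power I_homog le_term le_cls H_basis q_def d_def d_i).
    by move=> k Xk; apply: no_power; exists k.
  case: depth_m => s [<- pos_s reg_s]; rewrite leqNgt ltnS.
  by rewrite (regular_seq_leq I_homog I_neq0 le_term le_cls H_basis q_def d_def
    d_i reg_s pos_s).
(* Since H lies in I, the degree q condition puts all monomials of degree q into J. *)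
have deg_q m : mdeg m = q -> ideal_plus_vars I i 'X_[m].
  move=> deg_m; have idJ := ideal_plus_vars_is_ideal I (ltn_ord i).
  have /cond[gen _] : ('X_[m] : {mpoly K[n]}) \is q.-homog.
    by rewrite dhomogX; apply/eqP.
  move: gen; apply: gen_ideal_min => // f; rewrite mem_cat => /orP[Hf|/mapP[j + ->]].
    exact/ideal_plus_vars_ideal/(basis_ideal H_basis).
  rewrite mem_filter d_i ltnS => /andP[lt_j _]; apply: ideal_plus_vars_low => m'.
  rewrite msuppX inE => /eqP->; apply/(cls_leqP _ d_n).
  by exists j; rewrite ?mnm1E ?eqxx.
have reg_vars := first_vars_regular I_homog le_term le_cls H_basis q_def d_def d_i.
have sz_vars := size_first_vars I i.
have dim_le l := prime_chain_leq (l := l) I_homog deg_q.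
(* Both maxima are d-1: the variables x_1, ..., x_(d-1) attain them, and the dimension count bounds
   the depth as well, since depth is at most dimension. *)
exists i; split; split.
- exists (first_vars I i); split=> // a; exact: first_vars_pos_homog.
- by move=> r [s [<- pos_s reg_s]]; apply/dim_le/regular_seq_prime_chain.
- by rewrite -sz_vars; apply: regular_seq_prime_chain.
- exact: dim_le.
Qed.
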